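(* Fix $\lambda>m$. If $\mathbb E[\xi+\xi^{-1}+\nu^2]<\infty$, then almost surely $$\frac{C_n(\lambda)}{\mathbb E[C_n(\lambda)]}\longrightarrow W\qquad\text{as }n\to\infty.$$ If $\mathbb E[\xi^2+\xi^{-1}+\nu^3]<\infty$, then the limit $$\lim_{n\to\infty}\Big(\frac{\lambda}{m}\Big)^n\mathbb E[C_n(\lambda)]$$ exists and is strictly positive (and finite).
   Context: Let $\mathbf p=(p_k)_{k\ge0}$ be a probability distribution on the nonnegative integers with $p_0=0$ and finite mean $m=\sum_k kp_k>1$. Let $\mathbb T$ be a Galton–Watson tree with offspring distribution $\mathbf p$, rooted at $\varnothing$, and $\nu$ the number of children of the root. For a vertex $x$, $|x|$ is its depth and $\overleftarrow{x}$ its parent; $\mathbb T_n=\{x\in\mathbb T:|x|=n\}$; the edge $e=\{\overleftarrow x,x\}$ has depth $d(e)=|x|$. Let $\xi$ be a strictly positive random variable; conditionally on $\mathbb T$, $\{\xi(e)\}$ are i.i.d. copies of $\xi$. For $\lambda>0$, assign to each edge $e$ the resistance $\lambda^{d(e)}\xi(e)$, and let $C_n(\lambda)$ be the effective conductance in this network between $\varnothing$ and $\mathbb T_n$. $W=\lim_n m^{-n}\#\mathbb T_n$ (a.s. limit). *)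

(* Defs.v *)
From HB Require Import structures.
From mathcomp Require Import all_boot all_order all_algebra.
From mathcomp Require Import all_classical all_reals all_analysis.
Set Implicit Arguments. Unset Strict Implicit. Unset Printing Implicit Defensive.
Import Order.TTheory GRing.Theory Num.Theory.
Import numFieldNormedType.Exports.
Local Open Scope classical_set_scope.
Local Open Scope ring_scope.

(* Ulam--Harris labels, stored REVERSED: the label [:: i_k; ...; i_1]
   denotes the vertex reached from the root [::] by taking child i_1, then
   ..., then child i_k.  Hence the i-th child of v is (i :: v), the parent of
   a non-root vertex x is (behead x), and the depth |x| is (size x).
   The tree is encoded by the offspring numbers N v w of every label v
   (only those of vertices actually in the tree matter). *)
Definition label := seq nat.

Definition mutually_independent {d} {T : measurableType d} {R : realType}
  (P : probability T R) (I : eqType) (X : I -> T -> R) : Prop :=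
  forall (J : seq I) (B : I -> set R),
    uniq J -> (forall i, measurable (B i)) ->
    P (\bigcap_(i in [set` J]) (X i @^-1` B i))
    = (\prod_(i <- J) P (X i @^-1` B i))%E.

Section GW.
Context {T : Type} {R : realType}.
Variables (N : label -> T -> nat) (w : T).

Fixpoint gen (k : nat) : seq label :=
  match k with
  | 0 => [:: [::]]
  | k'.+1 => flatten [seq [seq i :: v | i <- iota 0 (N v w)] | v <- gen k']
  end.

Definition Zn (k : nat) : nat := size (gen k).

Variables (xi : label -> T -> R) (lam : R).

(* Dirichlet energy, in the network of edges of depth <= n, of a potential f;
   the edge {behead x, x} (with |x| = k+1) has resistance lam^(k+1) xi(x). *)
Definition energy (n : nat) (f : label -> R) : R :=
  \sum_(k < n) \sum_(x <- gen k.+1)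
     (f (behead x) - f x) ^+ 2 / (lam ^+ k.+1 * xi x w).

Definition admissible (n : nat) (f : label -> R) : Prop :=
  f [::] = 1 /\ (forall x, x \in gen n -> f x = 0).

(* Effective conductance between the root and T_n (Dirichlet principle). *)
Definition eff_cond (n : nat) : R :=
  inf [set energy n f | f in admissible n].
End GW.

Definition Cn {T : Type} {R : realType} (N : label -> T -> nat)
  (xi : label -> T -> R) (lam : R) (n : nat) (w : T) : R :=
  eff_cond N w xi lam n.

Definition ECn {d} {T : measurableType d} {R : realType} (P : probability T R)
  (N : label -> T -> nat) (xi : label -> T -> R) (lam : R) (n : nat) : R :=
  fine (\int[P]_w (Cn N xi lam n w)%:E)%E.

Definition Wlim {T : Type} {R : realType} (N : label -> T -> nat) (m : R)
  (w : T) : R :=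
  limn (fun n => (Zn N w n)%:R / m ^+ n).

(* Main.v *)
(** Write D_n for the conductance, rescaled to a root edge of depth 0, of a branch made
of one edge of resistance xi and a tree of depth n below it, and C_n for that of a tree
of depth n+1. Then C_n = lam^-1 * (sum of D_n over the children of the root) and
D_(n+1) = C_n / (1 + xi C_n).  With q = m / lam < 1 this gives E D_(n+1) <= q E D_n, and
the bound D_1^2 <= C_0 / xi makes second moments finite from depth 2 on, so that
E C_n^2 = O(q^(2n)); the loss E D_n q^-n - E D_(n+1) q^-(n+1) is then O(q^n).  Thomson's
principle for the flow proportional to the numbers of descendants keeps E D_n q^-n away
from 0, so it decreases to a limit L > 0.

For the almost sure statement, short-circuit the first n/2 generations: this changes
q^-n C_n by a summable amount in L^1, and the short-circuited conductance is a sum over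
generation n/2 of i.i.d. terms, within a summable amount in L^2 of its conditional mean
L Z_(n/2) m^-(n/2), up to a factor tending to 1. *)

Require Import Defs.
From HB Require Import structures.
From mathcomp Require Import all_boot all_order all_algebra.
From mathcomp Require Import all_classical all_reals all_analysis.
From mathcomp Require Import measurable_realfun ring lra.
Set Implicit Arguments. Unset Strict Implicit. Unset Printing Implicit Defensive.
Import Order.TTheory GRing.Theory Num.Theory.
Import numFieldNormedType.Exports.
Local Open Scope classical_set_scope.
Local Open Scope ring_scope.

(** * Cylinder sigma-algebra *)


(** The moment computations need independent, identically distributed subtrees. So [P] is pushed
    forward to the space of environments [label + label -> R], where a subtree is a reindexing of
    coordinates; the law enters through its product form on boxes and the invariance of its
    marginals under relabelling.

    The inverse weight is only assumed integrable, so a bare edge may have infinite second moment;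
    hence the delayed start of the second-moment bounds.

    Almost sure limits come from one principle: nonnegative functions with summable means tend to 0
    almost surely. The short-circuit error is nonnegative by Rayleigh monotonicity, so its L^1 norm
    is a difference of means. Cutting at half depth serves both errors: the short-circuit error is
    O(q^j) when depth j remains below the cut, and a centred sum over generation k is of relative
    order m^(-k/2). With j and k near n/2, both are geometric in n. *)

Section Cylinders.
Context {I : choiceType} {R : realType}.

Definition box (B : I -> set R) : set (I -> R) := [set e | forall i, B i (e i)].

Definition finite_box (s : seq I) (B : I -> set R) : Prop :=
  (forall i, measurable (B i)) /\ (forall i, i \notin s -> B i = setT).

Definition cylinder : set (set (I -> R)) :=
  [set A | exists s B, finite_box s B /\ A = box B].

Lemma cylinderI : setI_closed cylinder.
Proof.
move=> _ _ [s [B [[mB sB] ->]]] [t [C [[mC tC] ->]]].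
exists (s ++ t), (fun i => B i `&` C i); split; first split.
- by move=> i; exact: measurableI.
- move=> i; rewrite mem_cat negb_or => /andP[/sB -> /tC ->].
  by rewrite setTI.
- apply/seteqP; split => e /=.
  + by move=> [Be Ce] i; split; [exact: Be|exact: Ce].
  + by move=> H; split => i; have [] := H i.
Qed.

Lemma cylinderT : cylinder setT.
Proof.
exists [::], (fun=> setT); split; first by split.
by apply/seteqP; split.
Qed.

Definition env : measurableType (sigma_display cylinder) :=
  g_sigma_algebraType cylinder.

Lemma measurable_coord (i : I) : measurable_fun setT (fun e : env => e i).
Proof.
move=> _ B mB; rewrite setTI; apply: sub_sigma_algebra.
exists [:: i], (fun j => if j == i then B else setT); split; first split.
- by move=> j; case: eqP.
- by move=> j; rewrite inE => /negPf ->.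
- apply/seteqP; split => e /=.
  + by move=> Be j; case: eqP => // ->.
  + by move=> /(_ i); rewrite eqxx.
Qed.

Lemma box_bigcap (s : seq I) (B : I -> set R) : finite_box s B ->
  box B = \bigcap_(i in [set` s]) ((fun e : env => e i) @^-1` B i).
Proof.
move=> [_ sB]; apply/seteqP; split => e /= H.
- by move=> i _; exact: H.
- move=> i; have [/H//|/sB ->//] := boolP (i \in s).
Qed.

Lemma measurable_env d (T : measurableType d) (f : T -> env) :
  (forall i, measurable_fun setT (fun w => f w i)) -> measurable_fun setT f.
Proof.
move=> mf; have H := @measurability _ _ T env setT f cylinder erefl.
apply: H.
move=> _ [_ [s [B [fB ->]]] <-]; rewrite setTI (box_bigcap fB).
rewrite preimage_bigcap; apply: fin_bigcap_measurable => [|i _] /=; first exact: finite_seq.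
rewrite -[X in measurable X]setTI.
by apply: (mf i) => //; exact: fB.1.
Qed.

(** Cylinders are stable under intersection and include the whole space, so a finite measure is
    determined by its values on boxes. *)
Lemma env_measure_unique (m1 m2 : {measure set env -> \bar R}) :
  (forall s B, finite_box s B -> m1 (box B) = m2 (box B)) ->
  (m1 setT < +oo)%E ->
  forall A, measurable A -> m1 A = m2 A.
Proof.
move=> H fin A mA.
apply: (@measure_unique _ R env cylinder (fun=> setT) _ cylinderI
  (fun=> cylinderT) _ m1 m2 _ (fun=> fin) A mA) => //.
- by apply/seteqP; split => // e _; exists 0%N.
- by move=> _ [s [B [fB ->]]]; exact: H fB.
Qed.

End Cylinders.
Arguments env : clear implicits.

(** * Independent coordinates *)


Section IndependentCoordinates.
Context {I : choiceType} {R : realType}.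
Variable mu : probability (env I R) R.
Hypothesis mu_box : forall s B, uniq s -> finite_box s B ->
  mu (box B) = (\prod_(i <- s) mu [set e | B i (e i)])%E.

(** Projection onto the coordinates in [J], with zeros elsewhere so as to stay in the same space:
    independence of blocks becomes a statement about two self-maps of [env]. *)
Definition mask (J : pred I) (e : env I R) : env I R :=
  fun i => if J i then e i else 0.

Lemma measurable_mask J : measurable_fun setT (mask J).
Proof.
apply: measurable_env => i; rewrite /mask.
by case: (J i) => //; exact: measurable_coord.
Qed.

Definition depends_on (J : pred I) {U : Type} (f : env I R -> U) : Prop :=
  forall e e', (forall i, J i -> e i = e' i) -> f e = f e'.

Lemma depends_on_mask J U (f : env I R -> U) e :
  depends_on J f -> f (mask J e) = f e.
Proof. by move=> dJ; apply: dJ => i Ji; rewrite /mask Ji. Qed.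

Lemma measurable_preimage (f : env I R -> env I R) A :
  measurable_fun setT f -> measurable A -> measurable (f @^-1` A).
Proof.
by move=> mf mA; rewrite -[X in measurable X]setTI; exact: mf.
Qed.

Lemma measurable_box s (B : I -> set R) : finite_box s B ->
  measurable (box B : set (env I R)).
Proof. by move=> fB; apply: sub_sigma_algebra; exists s, B. Qed.

(** With [S] frozen, both sides are finite measures in [A], so agreement on boxes is enough.
    [mask_independent] applies this once for each of its two events. *)
Lemma independent_ext (f : env I R -> env I R) (S : set (env I R)) :
  measurable_fun setT f -> measurable S ->
  (forall s B, uniq s -> finite_box s B ->
     mu (f @^-1` box B `&` S) = (mu (f @^-1` box B) * mu S)%E) ->
  forall A, measurable A -> mu (f @^-1` A `&` S) = (mu (f @^-1` A) * mu S)%E.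
Proof.
move=> mf mS H A mA.
have r0 : 0 <= fine (mu S) by exact: fine_ge0.
pose X : {mfun env I R >-> env I R} := mfun_Sub (mem_set mf).
have XE : X = f :> (_ -> _) by [].
pose m1 : {measure set env I R -> \bar R} := mrestr mu mS.
pose m2 : {measure set env I R -> \bar R} := mscale (NngNum r0) (distribution mu X).
pose m1' : {measure set env I R -> \bar R} := pushforward m1 f.
have H1 B : m1' mf B = mu (f @^-1` B `&` S) by [].
have H2 B : m2 B = (mu (f @^-1` B) * mu S)%E.
  rewrite /m2 /= /mscale /= muleC; congr (_ * _)%E.
  by rewrite fineK// fin_num_measure.
rewrite -H1 -H2; apply: env_measure_unique => //.
- move=> s B [mB sB]; rewrite H1 H2; apply: (H (undup s)); first exact: undup_uniq.
  by split => // i; rewrite mem_undup; exact: sB.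
- rewrite H1; apply: le_lt_trans (ltry 1); apply: probability_le1.
  by apply: measurableI => //; exact: measurable_preimage.
Qed.

(** A masked coordinate is constantly 0, so a constraint on it is either void or impossible; this
    dichotomy lets box probabilities factor coordinate by coordinate. *)
Lemma mask_box J s (B : I -> set R) : finite_box s B ->
  exists2 B', finite_box s B' & mask J @^-1` box B = box B' /\
    forall i, ~~ J i -> B' i = setT \/ B' i = set0.
Proof.
move=> [mB sB]; exists (fun i => [set x | B i (if J i then x else 0)]).
  split.
    move=> i; case: (J i); first exact: mB.
    have [B0|B0] := pselect (B i 0).
      by rewrite (_ : [set _ | _] = setT)//; apply/seteqP; split.
    by rewrite (_ : [set _ | _] = set0)//; apply/seteqP; split.
  by move=> i /sB ->; apply/seteqP; split.
split; first by [].
move=> i /negPf ->.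
by have [B0|B0] := pselect (B i 0); [left|right]; apply/seteqP; split.
Qed.

Lemma mask_independent J K A B : (forall i, ~~ (J i && K i)) ->
  measurable A -> measurable B ->
  mu (mask J @^-1` A `&` mask K @^-1` B) =
  (mu (mask J @^-1` A) * mu (mask K @^-1` B))%E.
Proof.
move=> JK mA mB.
apply: independent_ext => //; [exact: measurable_mask| |].
  by apply: measurable_preimage => //; exact: measurable_mask.
move=> s A' us fA'; rewrite setIC [RHS]muleC.
apply: independent_ext => //; [exact: measurable_mask| |].
  by apply: measurable_preimage; [exact: measurable_mask|exact: measurable_box fA'].
move=> t B' ut fB'.
have fA2 : finite_box (undup (s ++ t)) A'.
  split; first exact: fA'.1.
  by move=> i; rewrite mem_undup mem_cat negb_or => /andP[/fA'.2].
have fB2 : finite_box (undup (s ++ t)) B'.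
  split; first exact: fB'.1.
  by move=> i; rewrite mem_undup mem_cat negb_or => /andP[_ /fB'.2].
have [A3 fA3 [-> HA]] := mask_box J fA2.
have [B3 fB3 [-> HB]] := mask_box K fB2.
have -> : box B3 `&` box A3 = box (fun i => B3 i `&` A3 i).
  apply/seteqP; split => e /=.
    by move=> [Be Ae] i; split; [exact: Be|exact: Ae].
  by move=> H; split => i; have [] := H i.
have fC : finite_box (undup (s ++ t)) (fun i => B3 i `&` A3 i).
  split; first by move=> i; apply: measurableI; [exact: fB3.1|exact: fA3.1].
  by move=> i ni; rewrite fA3.2// fB3.2// setTI.
rewrite !(mu_box (undup_uniq _) fC, mu_box (undup_uniq _) fB3,
  mu_box (undup_uniq _) fA3) -big_split /=.
apply: eq_bigr => i _.
rewrite -[[set e | (B3 i `&` A3 i) (e i)]]/([set e | B3 i (e i)] `&` [set e | A3 i (e i)]).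
have E0 : [set e : env I R | (set0 : set R) (e i)] = set0 by apply/seteqP; split.
have ET : [set e : env I R | [set: R] (e i)] = setT by apply/seteqP; split.
have /orP[/HA|/HB] : ~~ J i || ~~ K i by rewrite -negb_and.
- case=> ->; first by rewrite ET setIT probability_setT mule1.
  by rewrite E0 setI0 measure0 mule0.
- case=> ->; first by rewrite ET setTI probability_setT mul1e.
  by rewrite E0 set0I measure0 mul0e.
Qed.

(** The joint law of the two masks agrees with a product measure on rectangles, hence equals it;
    Tonelli then separates the integrals. *)
Lemma integralM_independent J K (f g : env I R -> R) :
  (forall i, ~~ (J i && K i)) ->
  measurable_fun setT f -> measurable_fun setT g ->
  (forall e, 0 <= f e) -> (forall e, 0 <= g e) ->
  depends_on J f -> depends_on K g ->
  (\int[mu]_e (f e * g e)%:E =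
   \int[mu]_e (f e)%:E * \int[mu]_e (g e)%:E)%E.
Proof.
move=> JK mf mg f0 g0 dJ dK.
pose XJ : {mfun env I R >-> env I R} := mfun_Sub (mem_set (measurable_mask J)).
pose XK : {mfun env I R >-> env I R} := mfun_Sub (mem_set (measurable_mask K)).
have mXY : measurable_fun setT (fun e => (mask J e, mask K e)).
  by apply/measurable_fun_pairP; split => /=; exact: measurable_mask.
pose XY : {mfun env I R >-> (env I R * env I R)%type} := mfun_Sub (mem_set mXY).
pose mJ := distribution mu XJ.
pose mK := distribution mu XK.
have fE : (\int[mu]_e (f e)%:E = \int[mJ]_e (f e)%:E)%E.
  rewrite ge0_integral_distribution;
    [|exact/measurable_EFinP|by move=> e; rewrite lee_fin].
  by apply: eq_integral => e _ /=; rewrite depends_on_mask.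
have gE : (\int[mu]_e (g e)%:E = \int[mK]_e (g e)%:E)%E.
  rewrite ge0_integral_distribution;
    [|exact/measurable_EFinP|by move=> e; rewrite lee_fin].
  by apply: eq_integral => e _ /=; rewrite depends_on_mask.
pose h (z : env I R * env I R) : \bar R := (f z.1 * g z.2)%:E.
have mh : measurable_fun setT h.
  apply/measurable_EFinP; apply: measurable_funM.
  - exact: measurableT_comp mf measurable_fst.
  - exact: measurableT_comp mg measurable_snd.
have h0 z : (0 <= h z)%E by rewrite lee_fin mulr_ge0.
have -> : (\int[mu]_e (f e * g e)%:E = \int[distribution mu XY]_z h z)%E.
  rewrite ge0_integral_distribution//.
  by apply: eq_integral => e _ /=; rewrite /h /= !depends_on_mask.
have -> : (\int[distribution mu XY]_z h z = \int[mJ \x mK]_z h z)%E.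
  apply: eq_measure_integral => A mA _; apply/esym.
  apply: product_measure_unique => // B C mB mC.
  exact: mask_independent.
rewrite fubini_tonelli1//.
rewrite (_ : fubini_F _ _ = fun x => ((\int[mK]_y (g y)%:E) * (f x)%:E)%E); last first.
  apply/funext => x; rewrite /fubini_F /h /=.
  under eq_integral do rewrite EFinM.
  rewrite ge0_integralZl//; last 3 first.
  - exact/measurable_EFinP.
  - by move=> e _; rewrite lee_fin.
  - by rewrite lee_fin.
  by rewrite muleC.
rewrite ge0_integralZl//; last 3 first.
- exact/measurable_EFinP.
- by move=> e _; rewrite lee_fin.
- by apply: integral_ge0 => e _; rewrite lee_fin.
by rewrite -fE -gE muleC.
Qed.

(** Injectivity keeps distinct coordinates distinct, so the reindexed field keeps its product form,
    and equal marginals then give equal laws. *)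
Lemma integral_reindex (s : I -> I) (f : env I R -> R) :
  injective s ->
  (forall i B, measurable B -> mu [set e | B (e (s i))] = mu [set e | B (e i)]) ->
  measurable_fun setT f -> (forall e, 0 <= f e) ->
  (\int[mu]_e (f (fun i => e (s i)))%:E = \int[mu]_e (f e)%:E)%E.
Proof.
move=> injs eqd mf f0.
have ms : measurable_fun setT (fun (e : env I R) => (fun i => e (s i)) : env I R).
  by apply: measurable_env => i; exact: measurable_coord.
pose X : {mfun env I R >-> env I R} := mfun_Sub (mem_set ms).
transitivity (\int[distribution mu X]_e (f e)%:E)%E.
  rewrite ge0_integral_distribution//; exact/measurable_EFinP.
apply: eq_measure_integral => A mA _.
apply: env_measure_unique => //; last first.
  by apply: le_lt_trans (ltry 1); exact: probability_le1.
move=> t B [mB tB]; rewrite /distribution /pushforward /=.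
have ut := undup_uniq t.
have fB : finite_box (undup t) B by split => // i; rewrite mem_undup; exact: tB.
rewrite (mu_box ut fB).
(* [B'] carries the constraint on [i] to the coordinate [s i] and leaves all coordinates outside the
   image of [undup t] free; the preimage picked is unique by [injs]. *)
pose B' j := if [pick i : seq_sub (undup t) | s (val i) == j] is Some i then B (val i) else setT.
have B's i : i \in undup t -> B' (s i) = B i.
  move=> it; rewrite /B'; case: pickP => [i' /eqP/injs -> //|/(_ (SeqSub it))].
  by rewrite eqxx.
have fB' : finite_box (map s (undup t)) B'.
  split; first by move=> j; rewrite /B'; case: pickP.
  move=> j; rewrite /B'; case: pickP => // -[i it] /= /eqP <-.
  by rewrite map_f.
transitivity (mu (box B')).
  congr (mu _); apply/seteqP; split => e /= H.
    move=> j; rewrite /B'; case: pickP => // -[i it] /= /eqP <-; exact: H.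
  move=> i; have [it|/fB.2 -> //] := boolP (i \in undup t).
  by rewrite -(B's i it); exact: H.
rewrite (mu_box _ fB') ?map_inj_uniq// big_map.
rewrite big_seq [RHS]big_seq; apply: eq_bigr => i it.
by rewrite B's// eqd.
Qed.

End IndependentCoordinates.

(** * Means of nonnegative functions *)


Section Mean.
Context {d : measure_display} {T : measurableType d} {R : realType}.
Variable P : probability T R.
Implicit Types (f g : T -> R) (x y : R).

(** Measurability, sign and finiteness travel with the value, so that expectations are computed as
    real numbers by composing rules. *)
Definition has_mean f x : Prop :=
  [/\ measurable_fun setT f, (forall w, 0 <= f w) &
      (\int[P]_w (f w)%:E = x%:E)%E].

Lemma has_mean_ge0 f x : has_mean f x -> 0 <= x.
Proof.
move=> [_ f0 fx]; rewrite -lee_fin -fx.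
by apply: integral_ge0 => w _; rewrite lee_fin.
Qed.

Lemma has_mean_unique f x y : has_mean f x -> has_mean f y -> x = y.
Proof. by move=> [_ _ fx] [_ _]; rewrite fx => -[]. Qed.

Lemma eq_has_mean g f x : f =1 g -> has_mean g x -> has_mean f x.
Proof. by move=> /funext ->. Qed.

Lemma has_meanD f g x y :
  has_mean f x -> has_mean g y -> has_mean (fun w => f w + g w) (x + y).
Proof.
move=> [mf f0 fx] [mg g0 gy]; split.
- exact: measurable_funD.
- by move=> w; exact: addr_ge0.
- under eq_integral do rewrite EFinD.
  rewrite ge0_integralD//; [by rewrite fx gy| | | |].
  + by move=> w _; rewrite lee_fin.
  + exact/measurable_EFinP.
  + by move=> w _; rewrite lee_fin.
  + exact/measurable_EFinP.
Qed.

Lemma has_meanZ a f x : 0 <= a -> has_mean f x ->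
  has_mean (fun w => a * f w) (a * x).
Proof.
move=> a0 [mf f0 fx]; split.
- by apply: measurable_funM => //; exact: measurable_cst.
- by move=> w; exact: mulr_ge0.
- under eq_integral do rewrite EFinM.
  rewrite ge0_integralZl; [by rewrite fx|by []|exact/measurable_EFinP| |].
  + by move=> w _; rewrite lee_fin.
  + by rewrite lee_fin.
Qed.

Lemma has_mean_cst a : 0 <= a -> has_mean (fun=> a) a.
Proof.
move=> a0; split => //.
by rewrite integral_cst//= probability_setT mule1.
Qed.

Lemma has_mean_le f g x y : has_mean f x -> has_mean g y ->
  (forall w, f w <= g w) -> x <= y.
Proof.
move=> [mf f0 fx] [mg g0 gy] fg; rewrite -lee_fin -fx -gy.
apply: ge0_le_integral => //;
  by (exact/measurable_EFinP || move=> w _; rewrite lee_fin).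
Qed.

Lemma has_mean_dom f g y : measurable_fun setT f -> (forall w, 0 <= f w) ->
  has_mean g y -> (forall w, f w <= g w) -> exists x, has_mean f x.
Proof.
move=> mf f0 [mg g0 gy] fg; exists (fine (\int[P]_w (f w)%:E)%E).
split => //; rewrite fineK// ge0_fin_numE; last first.
  by apply: integral_ge0 => w _; rewrite lee_fin.
apply: (@le_lt_trans _ _ y%:E); last exact: ltry.
rewrite -gy; apply: ge0_le_integral => //;
  by (exact/measurable_EFinP || move=> w _; rewrite lee_fin).
Qed.

Lemma has_mean_lty f : measurable_fun setT f -> (forall w, 0 <= f w) ->
  (\int[P]_w (f w)%:E < +oo)%E -> exists x, has_mean f x.
Proof.
move=> mf f0 fy; exists (fine (\int[P]_w (f w)%:E)%E).
split => //; rewrite fineK// ge0_fin_numE//.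
by apply: integral_ge0 => w _; rewrite lee_fin.
Qed.

Lemma has_meanB f g x y : has_mean f x -> has_mean g y ->
  (forall w, f w <= g w) -> has_mean (fun w => g w - f w) (y - x).
Proof.
move=> fx gy fg.
have [|w|w|z hz] := @has_mean_dom (fun w => g w - f w) g y _ _ gy.
- by case: fx gy => [? ? ?] [? ? ?]; exact: measurable_funB.
- by rewrite subr_ge0.
- by rewrite gerBl; case: fx.
have /has_mean_unique/(_ gy) <- : has_mean g (z + x).
  by apply: eq_has_mean (has_meanD hz fx) => w; rewrite subrK.
by rewrite addrK.
Qed.

Lemma has_mean_sum (n : nat) (f : 'I_n -> T -> R) (x : 'I_n -> R) :
  (forall i, has_mean (f i) (x i)) ->
  has_mean (fun w => \sum_(i < n) f i w) (\sum_(i < n) x i).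
Proof.
elim: n f x => [|n IH] f x H.
  rewrite big_ord0; apply: eq_has_mean (has_mean_cst (lexx 0)) => w.
  by rewrite big_ord0.
rewrite big_ord_recl; apply: eq_has_mean (has_meanD (H ord0) (IH _ _ (fun i => H (lift ord0 i)))).
by move=> w; rewrite big_ord_recl.
Qed.

Lemma has_mean_series (f : nat -> T -> R) (x : nat -> R) (h : T -> R) (X : R) :
  (forall n, has_mean (f n) (x n)) ->
  (forall w, series (f ^~ w) @ \oo --> h w) ->
  series x @ \oo --> X -> has_mean h X.
Proof.
move=> fx fh xX.
have f0 n w : 0 <= f n w by have [_ + _] := fx n; exact.
have mf n : measurable_fun setT (f n) by have [] := fx n.
have hE w : (h w)%:E = (\sum_(n <oo) (f n w)%:E)%E.
  apply/esym/cvg_lim => //.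
  rewrite (_ : (fun n => _) = EFin \o series (f ^~ w)).
    by apply: cvg_comp (fh w) _; exact: cvg_refl.
  by apply/funext => n; rewrite /series/= sumEFin.
split.
- apply: (@measurable_fun_cvg _ _ _ _ (fun n w => series (f ^~ w) n)) => [n|w _].
    rewrite /series/=; apply: measurable_sum => i; exact: mf.
  exact: fh.
- by move=> w; rewrite -lee_fin hE; apply: nneseries_ge0 => n _ _; rewrite lee_fin.
- under eq_integral do rewrite hE.
  rewrite integral_nneseries//.
  + apply/cvg_lim => //.
    rewrite (_ : (fun n => _) = EFin \o series x).
      by apply: cvg_comp xX _; exact: cvg_refl.
    apply/funext => n; rewrite /series/= -sumEFin; apply: eq_bigr => i _.
    by have [] := fx i.
  + by move=> n; exact/measurable_EFinP.
  + by move=> n w _; rewrite lee_fin.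
Qed.

(** The sum of the series is integrable by monotone convergence, hence finite almost everywhere.
    Every almost sure limit below rests on this. *)
Lemma ae_summable (f : nat -> T -> R) (x : nat -> R) :
  (forall n, has_mean (f n) (x n)) -> cvgn (series x) ->
  {ae P, forall w, cvgn (series (f ^~ w))}.
Proof.
move=> fx xX.
have f0 n w : 0 <= f n w by have [_ + _] := fx n; exact.
have mf n : measurable_fun setT (f n) by have [] := fx n.
pose h w := (\sum_(n <oo) (f n w)%:E)%E.
have h0 w : (0 <= h w)%E by apply: nneseries_ge0 => n _ _; rewrite lee_fin.
have mh : measurable_fun setT h.
  apply: ge0_emeasurable_sum => n *; [by rewrite lee_fin|exact/measurable_EFinP].
have hX : (\int[P]_w h w = (limn (series x))%:E)%E.
  rewrite integral_nneseries//.
  + apply/cvg_lim => //.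
    rewrite (_ : (fun n => _) = EFin \o series x).
      by apply: cvg_comp xX _; exact: cvg_refl.
    apply/funext => n; rewrite /series/= -sumEFin; apply: eq_bigr => i _.
    by have [] := fx i.
  + by move=> n; exact/measurable_EFinP.
  + by move=> n w _; rewrite lee_fin.
have ih : P.-integrable setT h.
  apply/integrableP; split => //.
  under eq_integral do rewrite gee0_abs//.
  by rewrite hX ltry.
have := integrable_ae measurableT ih.
apply: filterS => w /(_ I) hw.
apply: nondecreasing_is_cvgn; first exact: nondecreasing_series.
exists (fine (h w)) => _ [n _ <-].
rewrite -lee_fin fineK// /series/= -sumEFin.
by apply: nneseries_lim_ge => i _ _; rewrite lee_fin.
Qed.

End Mean.

(** * Branching sums over the children of the root *)


Lemma measurable_truncn {R : realType} : measurable_fun setT (@Num.truncn R).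
Proof.
move=> _ A _; rewrite setTI.
have -> : @Num.truncn R @^-1` A = \bigcup_(k in A) [set x | Num.truncn x = k].
  by apply/seteqP; split => [x Ax|x [k Ak /= xk]]; [exists (Num.truncn x)|rewrite /= xk].
apply: bigcup_measurable => k _; apply: is_interval_measurable => x y /= xk yk z /andP[xz zy] /=.
by apply/eqP; rewrite eqn_leq -[X in (_ <= X)%N && _]yk -[X in _ && (X <= _)%N]xk !le_truncn.
Qed.

Section Branching.
Context {R : realType}.
Local Notation idx := (label + label)%type.
Local Notation E := (env idx R).

Definition on_label (g : label -> label) (j : idx) : idx :=
  match j with inl v => inl (g v) | inr v => inr (g v) end.

(** Labels are reversed, so [rcons v i] is the vertex [v] of the subtree hanging from child [i] of
    the root. *)
Definition subtree (i : nat) (e : E) : E := fun j => e (on_label (rcons^~ i) j).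

(** Truncation decodes a natural number from a real coordinate, so that counts and weights live in
    one space of real fields. *)
Definition nchild (v : label) (e : E) : nat := Num.truncn (e (inl v)).

(* The weights are a.s. positive; forcing positivity everywhere spares a null set. *)
Definition weight (v : label) (e : E) : R :=
  if 0 < e (inr v) then e (inr v) else 1.

(** The branching operator: its [k]-th iterate sums [F] over the subtrees rooted in generation
    [k]. *)
Definition bsum (F : E -> R) (e : E) : R :=
  \sum_(i < nchild [::] e) F (subtree i e).

Lemma measurable_subtree i : measurable_fun setT (subtree i).
Proof. by apply: measurable_env => j; exact: measurable_coord. Qed.

Lemma measurable_nchild v : measurable_fun setT (nchild v).
Proof. exact: measurableT_comp measurable_truncn (measurable_coord _). Qed.

Lemma measurable_nchildR v (g : nat -> R) : measurable_fun setT (g \o nchild v).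
Proof. by apply: measurableT_comp (measurable_nchild v). Qed.

Lemma weight_gt0 v e : 0 < weight v e.
Proof. by rewrite /weight; case: ifP. Qed.

Lemma measurable_weight v : measurable_fun setT (weight v).
Proof.
have mc := measurable_coord (inr v : idx).
apply: (@measurable_fun_ifT _ _ _ _ (fun e : E => e (inr v)) (cst 1)) => //.
apply: measurable_fun_ltr => //; exact: measurable_cst.
Qed.

Lemma measurable_bsum F : measurable_fun setT F -> measurable_fun setT (bsum F).
Proof.
move=> mF _ B mB; rewrite setTI.
have -> : bsum F @^-1` B = \bigcup_k (nchild [::] @^-1` [set k] `&`
    (fun e => \sum_(i < k) F (subtree i e)) @^-1` B).
  apply/seteqP; split => [e Be|e [k _ [/= ek]]]; first by exists (nchild [::] e).
  by rewrite /= /bsum ek.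
apply: bigcupT_measurable => k; apply: measurableI.
- by rewrite -[X in measurable X]setTI; exact: measurable_nchild.
- rewrite -[X in measurable X]setTI.
  have mS : measurable_fun setT (fun e => \sum_(i < k) F (subtree i e)).
    by apply: measurable_sum => i; exact: measurableT_comp mF (measurable_subtree i).
  exact: mS.
Qed.

Lemma bsum_ge0 F e : (forall e', 0 <= F e') -> 0 <= bsum F e.
Proof. by move=> F0; apply: sumr_ge0. Qed.

(** The first step from the root is the last entry of a reversed label, hence [rev]. The coordinates
    of the root itself lie below no child. *)
Definition below (i : nat) : pred idx := fun j =>
  match j with inl v | inr v => ohead (rev v) == Some i end.

Lemma depends_subtree i {U} (F : E -> U) : depends_on (below i) (F \o subtree i).
Proof.
move=> e e' H; rewrite /= (_ : subtree i e = subtree i e')//.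
by apply/funext => -[v|v]; apply: H; rewrite /= rev_rcons /=.
Qed.

Lemma below_disj i i' : i != i' -> forall j, ~~ (below i j && below i' j).
Proof.
move=> /negP ii' [v|v]; apply/negP => /= /andP[/eqP -> /eqP[ii]];
  by apply: ii'; rewrite ii.
Qed.

Variable mu : probability E R.
Hypothesis mu_box : forall s B, uniq s -> finite_box s B ->
  mu (box B) = (\prod_(i <- s) mu [set e | B i (e i)])%E.
Hypothesis mu_on_label : forall g j B, measurable B ->
  mu [set e | B (e (on_label g j))] = mu [set e | B (e j)].
Local Notation has_mean := (has_mean mu).

Lemma has_mean_subtree i F x : has_mean F x -> has_mean (F \o subtree i) x.
Proof.
move=> [mF F0 Fx]; split.
- exact: measurableT_comp mF (measurable_subtree i).
- by move=> e; exact: F0.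
- rewrite -Fx /=; apply: (@integral_reindex idx R mu mu_box (on_label (rcons^~ i))) => //.
  + by move=> [v|v] [w|w] //= [] /rcons_inj[->].
  + by move=> j B mB; exact: mu_on_label.
Qed.

Lemma has_meanM (J K : pred idx) F G x y : (forall j, ~~ (J j && K j)) ->
  depends_on J F -> depends_on K G ->
  has_mean F x -> has_mean G y -> has_mean (fun e => F e * G e) (x * y).
Proof.
move=> JK dF dG [mF F0 Fx] [mG G0 Gy]; split.
- exact: measurable_funM.
- by move=> e; exact: mulr_ge0.
- by rewrite (integralM_independent mu_box JK)// Fx Gy.
Qed.

Lemma depends_nchild (g : nat -> R) : depends_on (pred1 (inl [::])) (g \o nchild [::]).
Proof. by move=> e e' H; rewrite /= /nchild H//=. Qed.

Lemma depends_weight (g : R -> R) : depends_on (pred1 (inr [::])) (g \o weight [::]).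
Proof. by move=> e e' H; rewrite /= /weight H//=. Qed.

Lemma depends_bsum F : depends_on (predC1 (inr [::])) (bsum F).
Proof.
move=> e e' H; rewrite /bsum /nchild H//.
apply: eq_bigr => i _; congr F.
by apply/funext => -[v|v]; apply: H => //=; apply/eqP => -[]; case: v.
Qed.

Variables (pk : nat -> R) (m c : R).
Hypothesis pkE : forall k, mu [set e | nchild [::] e = k] = (pk k)%:E.
Hypothesis pk_mean : series (fun k => k%:R * pk k) @ \oo --> m.

Lemma has_mean_nchild_eq k : has_mean (fun e => (nchild [::] e == k)%:R) (pk k).
Proof.
split.
- exact: (measurable_nchildR [::] (fun j => (j == k)%:R)).
- by move=> e.
- rewrite -pkE -[X in mu X]setIT -integral_indic//; last first.
    by rewrite -[X in measurable X]setTI; exact: (@measurable_nchild [::] measurableT [set k]).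
  apply: eq_integral => e _; rewrite indicE; apply: (congr1 (fun b : bool => b%:R%:E)).
  by apply/idP/idP => [/eqP ek|]; rewrite inE /=; [|move=> ->].
Qed.

Lemma pk_ge0 k : 0 <= pk k.
Proof. exact: has_mean_ge0 (has_mean_nchild_eq k). Qed.

(** [k * k.-1] counts ordered pairs of distinct children and is at most the square of [k], so the
    partial sums are bounded by the second moment. *)
Lemma cvg_factorial_moment z : has_mean (fun e => (nchild [::] e)%:R ^+ 2) z ->
  exists2 c : R, 0 <= c & series (fun k => (k * k.-1)%:R * pk k) @ \oo --> c.
Proof.
move=> Nz; have t0 k : 0 <= (k * k.-1)%:R * pk k by rewrite mulr_ge0// pk_ge0.
have cv : cvgn (series (fun k => (k * k.-1)%:R * pk k)).
  apply: nondecreasing_is_cvgn; first exact: nondecreasing_series.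
  exists z => _ [n _ <-]; rewrite /series /= big_mkord.
  apply: (has_mean_le (has_mean_sum (fun k : 'I_n =>
    has_meanZ (ler0n R (k * k.-1)) (has_mean_nchild_eq k))) Nz) => e.
  have [ln|nl] := ltnP (nchild [::] e) n; last first.
    rewrite big1 ?sqr_ge0// => i _; rewrite (_ : _ == _ = false) ?mulr0//.
    by apply/negP => /eqP H; move: nl; rewrite H leqNgt ltn_ord.
  rewrite (bigD1 (Ordinal ln))//= eqxx mulr1 big1 ?addr0 => [|i ni].
    by rewrite -natrX ler_nat -mulnn leq_mul2l leq_pred orbT.
  rewrite (_ : _ == _ = false) ?mulr0//.
  by apply/negP => /eqP H; move: ni; rewrite -val_eqE /= H eqxx.
exists (limn (series (fun k => (k * k.-1)%:R * pk k))) => //.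
by apply: limr_ge => //; apply: nearW => n; exact: sumr_ge0.
Qed.

(** Splitting on the number of children turns a sum of random length into finite sums; on each
    sample at most one term of the series is nonzero. *)
Lemma has_mean_nchild_series (h : E -> R) (a : nat -> R) A :
  (forall k, has_mean (fun e => (nchild [::] e == k)%:R * h e) (a k)) ->
  series a @ \oo --> A -> has_mean h A.
Proof.
move=> ha aA; apply: has_mean_series ha _ aA => e.
apply: (@cvg_near_cst _ _ _ _ _ _).
exists (nchild [::] e).+1 => // n /= ln.
rewrite /series /= big_mkord (bigD1 (Ordinal ln))//= eqxx mul1r.
rewrite big1 ?addr0// => i ni; rewrite (_ : _ == _ = false) ?mul0r//.
by apply/negP => /eqP H; move: ni; rewrite -val_eqE /= H eqxx.
Qed.

(** Wald's identity: the number of children is independent of each subtree. *)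
Lemma has_mean_bsum F x : has_mean F x -> has_mean (bsum F) (m * x).
Proof.
move=> Fx; apply: (@has_mean_nchild_series _ (fun k => x * (k%:R * pk k))).
- move=> k.
  apply: (@eq_has_mean _ _ _ _ (fun e => \sum_(i < k) (nchild [::] e == k)%:R * F (subtree i e))).
    move=> e; rewrite /bsum -mulr_sumr; case: eqP => [->//|_]; by rewrite !mul0r.
  rewrite (_ : x * _ = \sum_(i < k) pk k * x); last first.
    by rewrite sumr_const card_ord -[RHS]mulr_natl; ring.
  apply: has_mean_sum => i.
  apply: (@has_meanM (pred1 (inl [::])) (below i)).
  + by move=> j; apply/negP => /andP[/eqP ->].
  + exact: (depends_nchild (fun j => (j == k)%:R)).
  + exact: depends_subtree.
  + exact: has_mean_nchild_eq.
  + exact: has_mean_subtree.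
- rewrite (_ : series _ = (fun n => x * series (fun k => k%:R * pk k) n)).
    by rewrite mulrC; apply: cvgM => //; exact: cvg_cst.
  by apply/funext => n; rewrite /series/= mulr_sumr.
Qed.

Lemma has_mean_weightM F (g : R -> R) x y :
  has_mean (g \o weight [::]) x -> depends_on (predC1 (inr [::])) F -> has_mean F y ->
  has_mean (fun e => g (weight [::] e) * F e) (x * y).
Proof.
move=> gx dF Fy; apply: (@has_meanM (pred1 (inr [::])) (predC1 (inr [::])) _ _ _ _ _ _ _ gx Fy) => //.
- by move=> j; apply/negP => /= /andP[ja /negP[]].
- exact: depends_weight.
Qed.

Section SecondMoment.
Hypothesis pk_var : series (fun k => (k * k.-1)%:R * pk k) @ \oo --> c.

(** Given [k] children, the [k] diagonal pairs contribute [z] each; the [k * k.-1] pairs of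
    different subtrees are independent and contribute [x * y] each. *)
Lemma has_mean_bsumM F G x y z : has_mean F x -> has_mean G y ->
  has_mean (fun e => F e * G e) z ->
  has_mean (fun e => bsum F e * bsum G e) (m * z + c * (x * y)).
Proof.
move=> Fx Gy FGz.
apply: (@has_mean_nchild_series _
  (fun k => z * (k%:R * pk k) + (x * y) * ((k * k.-1)%:R * pk k))).
- move=> k.
  apply: (@eq_has_mean _ _ _ _ (fun e => \sum_(i < k) \sum_(j < k)
      (nchild [::] e == k)%:R * (F (subtree i e) * G (subtree j e)))).
    move=> e; rewrite /bsum; case: eqP => [->|_].
      rewrite mul1r mulr_suml; apply: eq_bigr => i _.
      by rewrite mulr_sumr; apply: eq_bigr => j _; rewrite mul1r.
    by rewrite mul0r big1// => i _; rewrite big1// => j _; rewrite mul0r.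
  rewrite (_ : _ + _ = \sum_(i < k) \sum_(j < k) pk k * (if i == j then z else x * y)); last first.
    under eq_bigr => i _.
      rewrite (bigD1 i)//= eqxx (eq_bigr (fun=> pk k * (x * y))); last first.
        by move=> j; rewrite eq_sym => /negPf ->.
      rewrite sumr_const -[X in _ + X]mulr_natl (_ : #|_| = k.-1); last first.
        by have := cardC1 i; rewrite card_ord.
      over.
    rewrite sumr_const card_ord -[RHS]mulr_natl natrM; ring.
  apply: has_mean_sum => i; apply: has_mean_sum => j.
  have [<-|ij] := eqVneq i j.
    apply: (@has_meanM (pred1 (inl [::])) (below i)).
    + by move=> l; apply/negP => /andP[/eqP ->].
    + exact: (depends_nchild (fun j => (j == k)%:R)).
    + exact: (@depends_subtree i _ (fun e => F e * G e)).
    + exact: has_mean_nchild_eq.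
    + exact: (has_mean_subtree i FGz).
  apply: (@has_meanM (pred1 (inl [::])) (predU (below i) (below j))).
  + by move=> l; apply/negP => /andP[/eqP ->].
  + exact: (depends_nchild (fun j => (j == k)%:R)).
  + move=> e e' H; congr (_ * _).
    * by apply: (@depends_subtree i _ F) => l li; apply: H; rewrite /= li.
    * by apply: (@depends_subtree j _ G) => l li; apply: H; rewrite /= li orbT.
  + exact: has_mean_nchild_eq.
  + apply: (has_meanM (below_disj ij)); try exact: depends_subtree.
    * exact: has_mean_subtree.
    * exact: has_mean_subtree.
- rewrite (_ : series _ = (fun n => z * series (fun k => k%:R * pk k) n +
      (x * y) * series (fun k => (k * k.-1)%:R * pk k) n)).
    by rewrite [m * z]mulrC [c * _]mulrC; apply: cvgD; apply: cvgM => //; exact: cvg_cst.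
  by apply/funext => n; rewrite /series/= !mulr_sumr big_split.
Qed.

End SecondMoment.

End Branching.

(** * Conductances of random trees *)


Lemma ler_of_sqr {R : realType} (a b : R) : 0 <= b -> a ^+ 2 <= b ^+ 2 -> a <= b.
Proof. by move=> b0 ab; rewrite leNgt; apply/negP => ba; nra. Qed.

Lemma cauchy_schwarz_step {R : realType} (S D G z d g : R) :
  0 <= D -> 0 <= G -> 0 <= d -> 0 <= g ->
  S ^+ 2 <= D * G -> z ^+ 2 <= d * g -> (S + z) ^+ 2 <= (D + d) * (G + g).
Proof.
move=> D0 G0 d0 g0 SDG zdg.
have H : 2 * (S * z) <= D * g + d * G.
  apply: ler_of_sqr; first by rewrite addr_ge0// mulr_ge0.
  have : (S ^+ 2) * (z ^+ 2) <= (D * G) * (d * g).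
    by apply: ler_pM => //; exact: sqr_ge0.
  by have := sqr_ge0 (D * g - d * G); nra.
nra.
Qed.

(** The hypothesis [z i ^+ 2 <= d i * g i] is an inequality because the bounds on the children
    arrive in that form in [thomson_Zn]. *)
Lemma cauchy_schwarz_sum {R : realType} n (z d g : 'I_n -> R) :
  (forall i, 0 <= d i) -> (forall i, 0 <= g i) ->
  (forall i, z i ^+ 2 <= d i * g i) ->
  (\sum_(i < n) z i) ^+ 2 <= (\sum_(i < n) d i) * (\sum_(i < n) g i).
Proof.
elim: n z d g => [|n IH] z d g d0 g0 H; first by rewrite !big_ord0 expr0n mulr0.
rewrite !big_ord_recr /=; apply: cauchy_schwarz_step => //.
- exact: sumr_ge0.
- exact: sumr_ge0.
- exact: IH.
Qed.

Section Network.
Context {R : realType}.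
Local Notation idx := (label + label)%type.
Local Notation E := (env idx R).
Variable lam : R.
Hypothesis lam0 : 0 < lam.
Local Notation gen := (@gen E (@nchild R)).
Local Notation energy := (fun n e => @energy E R (@nchild R) e (@weight R) lam n).
Implicit Types (e : E) (n k : nat).

(** * Generations decomposed at the children of the root *)

Lemma flatten_map_flatten (A B : Type) (f : A -> seq B) (ss : seq (seq A)) :
  flatten (map f (flatten ss)) = flatten [seq flatten (map f s) | s <- ss].
Proof. by elim: ss => //= s ss IH; rewrite map_cat flatten_cat IH. Qed.

(** [gen] grows at the leaves, whereas conductances recurse from the root; this passes from one
    description to the other. *)
Lemma gen_first_child e k : gen e k.+1 =
  flatten [seq [seq rcons x i | x : label <- gen (subtree i e) k] |
    i : nat <- iota 0 (nchild [::] e)].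
Proof.
elim: k e => [|k IH] e.
  by rewrite /= cats0; elim: (iota _ _) => //= i s ->.
rewrite [LHS]/= -/(gen e k.+1) IH flatten_map_flatten -map_comp; congr flatten.
apply: eq_map => i /=; rewrite map_flatten -!map_comp; congr flatten.
by apply: eq_map => v /=; rewrite -map_comp; apply: eq_map.
Qed.

Lemma size_gen e k x : x \in gen e k -> size x = k.
Proof.
elim: k x => [|k IH] x /=; first by rewrite inE => /eqP ->.
move=> /flattenP[s /mapP[v vk ->] /mapP[i _ ->]] /=.
by rewrite (IH v).
Qed.

Lemma rcons_gen e k i x : (i < nchild [::] e)%N -> x \in gen (subtree i e) k ->
  rcons x i \in gen e k.+1.
Proof.
move=> ie xk; rewrite gen_first_child; apply/flattenP.
exists [seq rcons y i | y : label <- gen (subtree i e) k]; last exact: map_f.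
by apply/mapP; exists i => //; rewrite mem_iota.
Qed.

Lemma sum_gen e k (g : label -> R) :
  \sum_(x <- gen e k.+1) g x =
  \sum_(i < nchild [::] e) \sum_(x <- gen (subtree i e) k) g (rcons x i).
Proof.
rewrite gen_first_child big_flatten big_map /=.
rewrite -[X in iota 0 X]subn0 -/(index_iota _ _) big_mkord.
by apply: eq_bigr => i _; rewrite big_map.
Qed.

Lemma ZnS k : (fun e => (Zn (@nchild R) e k.+1)%:R : R) =
  bsum (fun e => (Zn (@nchild R) e k)%:R).
Proof.
apply/funext => e; rewrite /bsum /Zn.
have H e' j : (size (gen e' j))%:R = \sum_(x <- gen e' j) (1 : R).
  by rewrite big_const_seq count_predT iter_addr_0.
by rewrite H sum_gen; apply: eq_bigr => i _; rewrite H.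
Qed.

Definition branch_energy n (a : R) (f : label -> R) e : R :=
  (a - f [::]) ^+ 2 / weight [::] e + energy n e f.

(** Every edge loses one level of depth when seen from a child, whence the factor [lam^-1]. *)
Lemma energyS n e f : energy n.+1 e f =
  lam^-1 * \sum_(i < nchild [::] e)
    branch_energy n (f [::]) (fun x => f (rcons x i)) (subtree i e).
Proof.
rewrite /branch_energy big_split /= mulrDr /Defs.energy big_ord_recl; congr (_ + _).
  rewrite sum_gen mulr_sumr; apply: eq_bigr => i _.
  by rewrite big_seq1 /= expr1 invfM mulrCA.
rewrite exchange_big mulr_sumr; apply: eq_bigr => k _.
rewrite lift0 sum_gen mulr_sumr; apply: eq_bigr => i _.
rewrite mulr_sumr; apply: eq_big_seq => x /size_gen.
case: x => // y s _ /=.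
by rewrite [lam ^+ _.+2]exprS !invfM -[lam^-1 / _ / _]mulrA mulrCA.
Qed.

(** [C / (1 + w C)] is the series law [1 / (w + 1 / C)], in a form that also covers [C = 0]. Index 0
    is the bare edge. *)
Fixpoint branch_cond n e : R :=
  match n with
  | 0 => (weight [::] e)^-1
  | n'.+1 => let C := lam^-1 * bsum (branch_cond n') e in
             C / (1 + weight [::] e * C)
  end.

Definition tree_cond n e : R := lam^-1 * bsum (branch_cond n) e.

Lemma branch_condS n e : branch_cond n.+1 e =
  tree_cond n e / (1 + weight [::] e * tree_cond n e).
Proof. by []. Qed.

Lemma branch_cond_ge0 n e : 0 <= branch_cond n e.
Proof.
have wp e' : 0 < weight [::] e' by exact: weight_gt0.
elim: n e => [|n IH] e; first by rewrite invr_ge0 ltW.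
have C0 : 0 <= tree_cond n e.
  by apply: mulr_ge0; [rewrite invr_ge0 ltW|exact: bsum_ge0].
rewrite branch_condS divr_ge0// addr_ge0// mulr_ge0// ltW//.
Qed.

Lemma tree_cond_ge0 n e : 0 <= tree_cond n e.
Proof.
by apply: mulr_ge0; [rewrite invr_ge0 ltW|apply: bsum_ge0 => e'; exact: branch_cond_ge0].
Qed.

(** Completing the square in the inner potential [b]: the gap vanishes exactly at
    [b = a / (1 + w C)], which yields both the lower bound and the minimiser. *)
Lemma series_resistance_gap (w C a b : R) : 0 < w -> 0 <= C ->
  (a - b) ^+ 2 / w + b ^+ 2 * C - a ^+ 2 * (C / (1 + w * C)) =
  ((1 + w * C) * b - a) ^+ 2 / (w * (1 + w * C)).
Proof.
move=> w0 C0.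
have w1 : 0 < 1 + w * C by apply: ltr_pwDl => //; rewrite mulr_ge0// ltW.
field; by rewrite !lt0r_neq0.
Qed.

Lemma le_branch_energy n a f e : (forall x, x \in gen e n -> f x = 0) ->
  a ^+ 2 * branch_cond n e <= branch_energy n a f e.
Proof.
elim: n a f e => [|n IH] a f e f0; rewrite /branch_energy.
  by rewrite (f0 [::])// subr0 /Defs.energy big_ord0 addr0.
rewrite branch_condS; set C := tree_cond n e.
have w0 := weight_gt0 [::] e; have C0 := tree_cond_ge0 n e.
apply: (@le_trans _ _ ((a - f [::]) ^+ 2 / weight [::] e + f [::] ^+ 2 * C)).
  rewrite -subr_ge0 series_resistance_gap//; apply: divr_ge0; first exact: sqr_ge0.
  by apply: mulr_ge0; [exact: ltW|apply: addr_ge0 => //; apply: mulr_ge0 => //; exact: ltW].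
rewrite lerD2l energyS /C /tree_cond mulrCA.
rewrite ler_pM2l ?invr_gt0// /bsum mulr_sumr; apply: ler_sum => i _.
by apply: IH => x xi; apply: f0; exact: rcons_gen.
Qed.

Lemma energy_attained n e :
  (forall i a, exists f, (forall x, x \in gen (subtree i e) n -> f x = 0) /\
     branch_energy n a f (subtree i e) = a ^+ 2 * branch_cond n (subtree i e)) ->
  forall b, exists f, [/\ f [::] = b, (forall x, x \in gen e n.+1 -> f x = 0) &
     energy n.+1 e f = b ^+ 2 * tree_cond n e].
Proof.
move=> H b.
have /choice[F HF] : forall i, exists f, (forall x, x \in gen (subtree i e) n -> f x = 0) /\
     branch_energy n b f (subtree i e) = b ^+ 2 * branch_cond n (subtree i e).
  by move=> i; exact: H.
(* Gluing of the branch minimisers: [rev x] exposes the child of the root through which [x] is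
   reached. *)
pose f x := if rev x is i :: y then F i (rev y) else b.
have fr i : (fun x => f (rcons x i)) = F i.
  by apply/funext => x; rewrite /f rev_rcons revK.
exists f; split => //.
- move=> x; rewrite gen_first_child => /flattenP[_ /mapP[i _ ->]] /mapP[y yi ->].
  by rewrite -[f _]/((fun x => f (rcons x i)) y) fr; exact: (HF i).1.
- rewrite energyS /tree_cond mulrCA; congr (_ * _); rewrite /bsum mulr_sumr.
  by apply: eq_bigr => i _; rewrite fr; exact: (HF i).2.
Qed.

Lemma branch_energy_attained n a e :
  exists f, (forall x, x \in gen e n -> f x = 0) /\
     branch_energy n a f e = a ^+ 2 * branch_cond n e.
Proof.
elim: n a e => [|n IH] a e.
  exists (fun=> 0); split => //.
  by rewrite /branch_energy subr0 /Defs.energy big_ord0 addr0.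
have w0 := weight_gt0 [::] e; have C0 := tree_cond_ge0 n e.
have w1 : 0 < 1 + weight [::] e * tree_cond n e.
  by apply: ltr_pwDl => //; rewrite mulr_ge0// ltW.
(* This potential at the lower end of the edge makes the gap of [series_resistance_gap] vanish. *)
have [f [fb f0 fE]] := energy_attained (fun i a => IH a (subtree i e))
  (a / (1 + weight [::] e * tree_cond n e)).
exists f; split => //; rewrite /branch_energy fE fb branch_condS.
apply/eqP; rewrite -subr_eq0 series_resistance_gap//.
rewrite [(1 + _) * _]mulrC mulfVK ?lt0r_neq0// subrr expr0n mul0r //.
Qed.

Lemma eff_cond_tree_cond n e :
  eff_cond (@nchild R) e (@weight R) lam n.+1 = tree_cond n e.
Proof.
have [f [fb f0 fE]] := energy_attained (fun i a => branch_energy_attained n a (subtree i e)) 1.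
rewrite expr1n mul1r in fE.
have lb : lbound [set energy n.+1 e f | f in admissible (@nchild R) e n.+1] (tree_cond n e).
  move=> _ [g [g1 g0] <-].
  rewrite energyS ler_pM2l ?invr_gt0//.
  apply: ler_sum => i _.
  rewrite -[X in X <= _]mul1r -[X in X * _](expr1n _ 2) -g1.
  by apply: le_branch_energy => x xi; apply: g0; exact: rcons_gen.
apply/le_anti/andP; split.
- by rewrite -fE; apply: ge_inf; [exists (tree_cond n e)|exists f].
- by apply: lb_le_inf => //; exists (energy n.+1 e f); exists f.
Qed.

(** * Thomson's principle and lower bounds on conductances *)

Fixpoint flow_energy n e : R :=
  weight [::] e * (Zn (@nchild R) e n)%:R ^+ 2 +
  match n with 0 => 0 | n'.+1 => lam * bsum (flow_energy n') e end.

Lemma flow_energy_ge0 n e : 0 <= flow_energy n e.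
Proof.
elim: n e => [|n IH] e /=; rewrite addr_ge0//.
- by rewrite mulr_ge0 ?sqr_ge0// ltW// weight_gt0.
- by rewrite mulr_ge0 ?sqr_ge0// ltW// weight_gt0.
- by apply: mulr_ge0; [exact: ltW|exact: bsum_ge0].
Qed.

(* Thomson's principle for the flow that sends Z_n(x) through x, obtained
   inductively from Cauchy-Schwarz instead of from flows. *)
Lemma thomson_Zn n e :
  (Zn (@nchild R) e n)%:R ^+ 2 <= branch_cond n e * flow_energy n e.
Proof.
elim: n e => [|n IH] e.
  by rewrite /= addr0 mulrA mulVf ?mul1r// lt0r_neq0// weight_gt0.
have w0 := weight_gt0 [::] e; have C0 := tree_cond_ge0 n e.
have w1 : 0 < 1 + weight [::] e * tree_cond n e.
  by apply: ltr_pwDl => //; rewrite mulr_ge0// ltW.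
have CS : (Zn (@nchild R) e n.+1)%:R ^+ 2 <= tree_cond n e * (lam * bsum (flow_energy n) e).
  have -> : (Zn (@nchild R) e n.+1)%:R = bsum (fun e => (Zn (@nchild R) e n)%:R) e.
    by rewrite -ZnS.
  rewrite /tree_cond mulrACA mulVf ?lt0r_neq0// mul1r.
  apply: cauchy_schwarz_sum => i; [exact: branch_cond_ge0|exact: flow_energy_ge0|exact: IH].
rewrite branch_condS [flow_energy n.+1 e]/=.
move: CS; set Z := _ ^+ 2; set Fl := lam * _ => CS.
(* Once the denominator is cleared, the terms containing the weight cancel and [CS] remains. *)
rewrite mulrAC ler_pdivlMr//.
nra.
Qed.

(** A quotient of [Z ^+ 2] by the flow energy does not pass to expectations; its linearisation with
    a free constant [t] does, using only the means of both. *)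
Lemma le_branch_cond_Zn n e t :
  2 * t * (Zn (@nchild R) e n)%:R <= branch_cond n e + t ^+ 2 * flow_energy n e.
Proof.
have := thomson_Zn n e; have := branch_cond_ge0 n e; have := flow_energy_ge0 n e.
move: (branch_cond n e) (flow_energy n e) => D G G0 D0; set Z := _%:R => H.
apply: ler_of_sqr; first by rewrite addr_ge0// mulr_ge0 ?sqr_ge0.
have : t ^+ 2 * Z ^+ 2 <= t ^+ 2 * (D * G) by apply: ler_wpM2l => //; exact: sqr_ge0.
by have := sqr_ge0 (D - t ^+ 2 * G); nra.
Qed.

End Network.

(** * Moments and almost sure convergence *)


(** Both error estimates decay in [n./2]. With [s] the square root of [r], [r ^+ n./2] is [s] to the
    power [n] or [n - 1], whence the ratio [s] and the factor [1 / s]. *)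
Lemma cvg_series_half_power {R : realType} (r K : R) (x : nat -> R) :
  0 < r -> r < 1 -> (forall n, 0 <= x n) -> (forall n, x n <= K * r ^+ n./2) ->
  cvgn (series x).
Proof.
move=> r0 r1 x0 xK.
pose s := Num.sqrt r.
have s0 : 0 < s by rewrite sqrtr_gt0.
have s1 : s < 1 by rewrite -[ltRHS]sqrtr1 ltr_sqrt.
have sE : s ^+ 2 = r by rewrite sqr_sqrtr// ltW.
have K0 : 0 <= K by have := le_trans (x0 0) (xK 0); rewrite expr0 mulr1.
apply: (@series_le_cvg _ _ (geometric (K / s) s)) => //.
- by move=> n; apply: mulr_ge0; [rewrite divr_ge0// ltW|rewrite exprn_ge0// ltW].
- move=> n; apply: le_trans (xK n) _; rewrite /geometric /= -mulrA ler_wpM2l//.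
  rewrite mulrC ler_pdivlMr// -sE -exprM mul2n -exprSr.
  apply: ler_wiXn2l; [exact: ltW|exact: ltW|].
  by rewrite -{1}(odd_double_half n); case: (odd n); rewrite ?add0n.
- by apply: is_cvg_geometric_series; rewrite ger0_norm// ltW.
Qed.

Lemma cvg_to0_of_norm_series {R : realType} (u : nat -> R) :
  cvgn (series (fun n => `|u n|)) -> u @ \oo --> 0.
Proof. by move=> /cvg_series_cvg_0; exact: norm_cvg0. Qed.

Section AbsMean.
Context {d : measure_display} {T : measurableType d} {R : realType}.
Variable P : probability T R.

(** A substitute for Cauchy-Schwarz: [|X| <= t + X^2 / t], to be used with [t] of the order of the
    standard deviation. *)
Lemma has_mean_norm (X : T -> R) v t : measurable_fun setT X ->
  has_mean P (fun w => X w ^+ 2) v -> 0 < t ->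
  exists2 x, has_mean P (fun w => `|X w|) x & x <= t + v / t.
Proof.
move=> mX Xv t0.
have dom w : `|X w| <= t + t^-1 * X w ^+ 2.
  rewrite -(ler_pM2l t0) mulrDr mulVKf ?lt0r_neq0//.
  rewrite -(real_normK (num_real (X w))); have := normr_ge0 (X w).
  by move: `|_| => a a0; have := sqr_ge0 (t - a); nra.
have tv : has_mean P (fun w => t + t^-1 * X w ^+ 2) (t + v / t).
  rewrite [v / t]mulrC; apply: has_meanD; first by apply: has_mean_cst; exact: ltW.
  by apply: has_meanZ => //; rewrite invr_ge0 ltW.
have mN : measurable_fun setT (fun w => `|X w|) by exact: measurableT_comp.
have [x Xx] := has_mean_dom mN (fun w => normr_ge0 (X w)) tv dom.
by exists x => //; exact: has_mean_le Xx tv dom.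
Qed.

End AbsMean.

Ltac nonneg := by repeat first
  [ done | exact: ltW | exact: sqr_ge0 | apply: exprn_ge0 | apply: addr_ge0
  | apply: divr_ge0 | apply: mulr_ge0 | rewrite invr_ge0 ].

Lemma ler_sqr_of {R : realType} (x y : R) : 0 <= x -> x <= y -> x ^+ 2 <= y ^+ 2.
Proof. by move=> x0 xy; rewrite !expr2; apply: ler_pM. Qed.

Section Moments.
Context {R : realType}.
Local Notation idx := (label + label)%type.
Local Notation E := (env idx R).
Variable mu : probability E R.
Hypothesis mu_box : forall s B, uniq s -> finite_box s B ->
  mu (box B) = (\prod_(i <- s) mu [set e | B i (e i)])%E.
Hypothesis mu_on_label : forall g j B, measurable B ->
  mu [set e | B (e (on_label g j))] = mu [set e | B (e j)].
Local Notation has_mean := (has_mean mu).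
Variables (pk : nat -> R) (m c : R).
Hypothesis pkE : forall k, mu [set e | nchild [::] e = k] = (pk k)%:E.
Hypothesis pk_mean : series (fun k => k%:R * pk k) @ \oo --> m.
Hypothesis pk_var : series (fun k => (k * k.-1)%:R * pk k) @ \oo --> c.
Hypothesis c0 : 0 <= c.
Variables (lam kap io : R).
Hypotheses (m1 : 1 < m) (mlam : m < lam).
Hypothesis has_mean_weight : has_mean (weight [::]) kap.
Hypothesis has_mean_weightV : has_mean (fun e => (weight [::] e)^-1) io.
Local Notation Z := (fun n e => (Zn (@nchild R) e n)%:R : R).
Local Notation D := (branch_cond lam).
Local Notation C := (tree_cond lam).
Local Notation q := (m / lam).

Let m0 : 0 < m. Proof. by apply: lt_trans m1. Qed.
Let lam0 : 0 < lam. Proof. exact: lt_trans mlam. Qed.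
Let q0 : 0 < q. Proof. exact: divr_gt0. Qed.
Let w0 (e : E) : 0 < weight [::] e. Proof. exact: weight_gt0. Qed.
Let C0 n (e : E) : 0 <= C n e. Proof. exact: tree_cond_ge0. Qed.
Let D0 n (e : E) : 0 <= D n e. Proof. exact: branch_cond_ge0. Qed.
Let wC0 n (e : E) : 0 < 1 + weight [::] e * C n e.
Proof. by apply: ltr_pwDl => //; rewrite mulr_ge0// ltW. Qed.

Lemma measurable_branch_cond n : measurable_fun setT (D n).
Proof.
elim: n => [|n IH]; first by case: has_mean_weightV.
have mC : measurable_fun setT (C n).
  by apply: measurable_funM; [exact: measurable_cst|exact: measurable_bsum].
rewrite (_ : D n.+1 = fun e => C n e * (1 + weight [::] e * C n e)^-1)//.
apply: (measurable_funM mC).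
rewrite (_ : (fun e => _) = fun e => (1 + weight [::] e * C n e) `^ (-1)); last first.
  by apply/funext => e; rewrite powR_inv1// ltW.
have mwC : measurable_fun setT (fun e => 1 + weight [::] e * C n e).
  apply: measurable_funD; first exact: measurable_cst.
  by apply: measurable_funM => //; exact: measurable_weight.
exact: (measurableT_comp (measurable_powR (-1)) mwC).
Qed.

Lemma measurable_tree_cond n : measurable_fun setT (C n).
Proof.
apply: measurable_funM; first exact: measurable_cst.
by apply: measurable_bsum; exact: measurable_branch_cond.
Qed.

Lemma depends_tree_cond n : depends_on (predC1 (inr [::])) (C n).
Proof. by move=> e e' H; rewrite /tree_cond (depends_bsum _ H). Qed.

Lemma branch_le_tree n e : D n.+1 e <= C n e.
Proof.
by rewrite branch_condS ler_pdivrMr// ler_peMr// lerDl mulr_ge0// ltW.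
Qed.

Lemma branch_le_weightV n e : D n e <= (weight [::] e)^-1.
Proof.
case: n => [//|n]; rewrite branch_condS ler_pdivrMr//.
by rewrite mulrDr mulr1 mulKf ?lt0r_neq0// lerDr invr_ge0 ltW.
Qed.

Definition branch_mean n : R := fine (\int[mu]_e (D n e)%:E)%E.
Local Notation al := branch_mean.

Lemma has_mean_branch n : has_mean (D n) (al n).
Proof.
suff [x Dx] : exists x, has_mean (D n) x.
  by rewrite /branch_mean; have [_ _ ->] := Dx.
apply: (has_mean_dom (measurable_branch_cond n) (D0 n) has_mean_weightV).
exact: branch_le_weightV.
Qed.

Lemma has_mean_tree n : has_mean (C n) (q * al n).
Proof.
rewrite [q]mulrC -mulrA; apply: has_meanZ; first by rewrite invr_ge0 ltW.
exact: (has_mean_bsum mu_box mu_on_label pkE pk_mean (has_mean_branch n)).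
Qed.

Lemma branch_meanS n : al n.+1 <= q * al n.
Proof. exact: has_mean_le (has_mean_branch _) (has_mean_tree n) (branch_le_tree n). Qed.

Lemma branch_mean_ge0 n : 0 <= al n.
Proof. exact: has_mean_ge0 (has_mean_branch n). Qed.

Lemma branch_mean_le n : al n <= io * q ^+ n.
Proof.
elim: n => [|n IH].
  by rewrite expr0 mulr1; apply: has_mean_le (has_mean_branch 0) has_mean_weightV _.
apply: le_trans (branch_meanS n) _; rewrite exprS mulrCA ler_pM2l//.
Qed.

(** * Second moments of conductances *)

Lemma has_mean_tree_sq n b : has_mean (fun e => D n e ^+ 2) b ->
  has_mean (fun e => C n e ^+ 2) (lam^-1 ^+ 2 * (m * b + c * al n ^+ 2)).
Proof.
move=> Db; apply: (@eq_has_mean _ _ _ _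
    (fun e => lam^-1 ^+ 2 * (bsum (D n) e * bsum (D n) e))).
  by move=> e; rewrite /tree_cond exprMn [bsum _ _ ^+ 2]expr2.
apply: has_meanZ; first exact: sqr_ge0.
rewrite [al n ^+ 2]expr2.
exact: (has_mean_bsumM mu_box mu_on_label pkE pk_mean pk_var (has_mean_branch n) (has_mean_branch n) Db).
Qed.

Lemma branch_sq_bound : exists2 B, 0 <= B & forall n,
  exists2 b, has_mean (fun e => D n.+1 e ^+ 2) b & b <= B * (q ^+ n.+1) ^+ 2.
Proof.
have msq n : measurable_fun setT (fun e => D n e ^+ 2).
  by apply: measurable_funX; exact: measurable_branch_cond.
(* [D 0] need not be square integrable. In the square of [D 1], one factor is bounded by the inverse
   root weight and the other by [C 0], which is independent of that weight. *)
have [b1 Db1] : exists b, has_mean (fun e => D 1 e ^+ 2) b.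
  have wC := has_mean_weightM mu_box (g := GRing.inv) has_mean_weightV (@depends_tree_cond 0) (has_mean_tree 0).
  apply: (has_mean_dom (msq 1) (fun e => sqr_ge0 _) wC) => e.
  by rewrite expr2; apply: ler_pM => //; [exact: branch_le_weightV|exact: branch_le_tree].
have b10 := has_mean_ge0 Db1.
have io0 := has_mean_ge0 has_mean_weightV.
(* The second summand gives [B * m + c * io ^+ 2 <= B * m ^+ 2], which lets the recursion preserve
   the bound; the first one starts it at depth 1. *)
pose B := b1 / q ^+ 2 + c * io ^+ 2 / (m * (m - 1)).
have m10 : 0 < m - 1 by rewrite subr_gt0.
have B1 : b1 <= B * q ^+ 2.
  rewrite mulrDl mulfVK ?lt0r_neq0 ?exprn_gt0// lerDl.
  nonneg.
have B2 : B * m + c * io ^+ 2 <= B * m ^+ 2.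
  have : c * io ^+ 2 / (m * (m - 1)) <= B by rewrite lerDr; nonneg.
  by rewrite ler_pdivrMr ?mulr_gt0//; nra.
have B0 : 0 <= B.
  nonneg.
exists B => // n; elim: n => [|n [b Db bB]]; first by exists b1.
have Cb := has_mean_tree_sq Db.
have [b' Db'] : exists b', has_mean (fun e => D n.+2 e ^+ 2) b'.
  apply: (has_mean_dom (msq _) (fun e => sqr_ge0 _) Cb) => e.
  by apply: ler_sqr_of => //; exact: branch_le_tree.
exists b' => //; apply: (@le_trans _ _ (lam^-1 ^+ 2 * (m * b + c * al n.+1 ^+ 2))).
  by apply: has_mean_le Db' Cb _ => e; apply: ler_sqr_of => //; exact: branch_le_tree.
have al2 : al n.+1 ^+ 2 <= io ^+ 2 * (q ^+ n.+1) ^+ 2.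
  by rewrite -exprMn; apply: ler_sqr_of; [exact: branch_mean_ge0|exact: branch_mean_le].
rewrite [q ^+ n.+2]exprS [X in _ <= B * X]exprMn [X in _ <= B * (X * _)]exprMn.
set Q := (q ^+ n.+1) ^+ 2 in bB al2 *.
have Q0 : 0 <= Q by exact: sqr_ge0.
have -> : B * (m ^+ 2 * lam^-1 ^+ 2 * Q) = lam^-1 ^+ 2 * (B * m ^+ 2 * Q) by ring.
apply: ler_wpM2l; first exact: sqr_ge0.
apply: (@le_trans _ _ ((B * m + c * io ^+ 2) * Q)); last exact: ler_wpM2r.
have -> : (B * m + c * io ^+ 2) * Q = m * (B * Q) + c * (io ^+ 2 * Q) by ring.
by apply: lerD; apply: ler_wpM2l => //; exact: ltW.
Qed.

Lemma tree_sq_bound : exists2 B, 0 <= B & forall n,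
  exists2 b, has_mean (fun e => C n.+1 e ^+ 2) b & b <= B * (q ^+ n.+2) ^+ 2.
Proof.
have [B B0 HB] := branch_sq_bound.
exists (B + c * io ^+ 2 / m ^+ 2 ).
  nonneg.
move=> n; have [b Db bB] := HB n.
have Cb := has_mean_tree_sq Db.
exists (lam^-1 ^+ 2 * (m * b + c * al n.+1 ^+ 2)) => //.
have al2 : al n.+1 ^+ 2 <= io ^+ 2 * (q ^+ n.+1) ^+ 2.
  by rewrite -exprMn; apply: ler_sqr_of; [exact: branch_mean_ge0|exact: branch_mean_le].
rewrite [q ^+ n.+2]exprS [X in _ <= _ * X]exprMn [X in _ <= _ * (X * _)]exprMn.
set Q := (q ^+ n.+1) ^+ 2 in bB al2 *.
have Q0 : 0 <= Q by exact: sqr_ge0.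
have -> : (B + c * io ^+ 2 / m ^+ 2) * (m ^+ 2 * lam^-1 ^+ 2 * Q) =
   lam^-1 ^+ 2 * (m ^+ 2 * (B * Q) + c * (io ^+ 2 * Q)).
  by field; rewrite !lt0r_neq0.
apply: ler_wpM2l; first exact: sqr_ge0.
apply: lerD; last exact: ler_wpM2l.
apply: (@le_trans _ _ (m ^+ 2 * b)); last by apply: ler_wpM2l => //; exact: sqr_ge0.
by apply: ler_wpM2r; [exact: has_mean_ge0 Db|rewrite expr2 ler_peMr ?ltW].
Qed.

(** [x - x / (1 + w x) <= w x^2], and the root weight is independent of the tree below, so one step
    loses at most [kap] times a second moment. *)
Lemma branch_mean_decrement : exists2 B, 0 <= B &
  forall n, q * al n.+1 - B * (q ^+ n.+2) ^+ 2 <= al n.+2.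
Proof.
have [B B0 HB] := tree_sq_bound.
have kap0 := has_mean_ge0 has_mean_weight.
exists (kap * B) => [|n]; first exact: mulr_ge0.
have [b Cb bB] := HB n.
have wC2 : has_mean (fun e => weight [::] e * C n.+1 e ^+ 2) (kap * b).
  apply: (has_mean_weightM mu_box (g := id)) => //.
  by move=> e e' H; rewrite (depends_tree_cond _ H).
have : q * al n.+1 <= al n.+2 + kap * b.
  apply: has_mean_le (has_mean_tree n.+1) (has_meanD (has_mean_branch n.+2) wC2) _ => e.
  rewrite branch_condS -lerBlDr ler_pdivlMr//.
  have := w0 e; have := C0 n.+1 e; move: (weight _ _) (C _ _) => w x x0 ww.
  have : 0 <= w ^+ 2 * x ^+ 3 by rewrite mulr_ge0 ?exprn_ge0// ltW.
  by nra.
have : kap * b <= kap * (B * (q ^+ n.+2) ^+ 2) by exact: ler_wpM2l.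
rewrite mulrA; lra.
Qed.

(** * Moments of generation sizes and of the flow energy *)

Lemma measurable_Zn n : measurable_fun setT (Z n).
Proof.
elim: n => [|n IH]; first exact: measurable_cst.
by rewrite ZnS; exact: measurable_bsum.
Qed.

Lemma has_mean_Zn n : has_mean (Z n) (m ^+ n).
Proof.
elim: n => [|n IH]; first by rewrite expr0; exact: has_mean_cst.
by rewrite ZnS exprS; exact: (has_mean_bsum mu_box mu_on_label pkE pk_mean).
Qed.

Lemma Zn_sq_bound : exists2 K, 0 <= K & forall n,
  exists2 z, has_mean (fun e => Z n e ^+ 2) z & z <= K * (m ^+ n) ^+ 2.
Proof.
have m10 : 0 < m - 1 by rewrite subr_gt0.
(* Chosen so that [K * m + c <= K * m ^+ 2], which closes the recursion for the second moment. *)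
pose K := 1 + c / (m * (m - 1)).
have cK : K * m + c <= K * m ^+ 2.
  have : c / (m * (m - 1)) <= K by rewrite lerDr.
  by rewrite ler_pdivrMr ?mulr_gt0//; nra.
have K0 : 0 <= c / (m * (m - 1)) by nonneg.
exists K; first by rewrite addr_ge0.
elim=> [|n [z Zz zK]].
  exists 1; last by rewrite expr0 expr1n mulr1 lerDl.
  by apply: eq_has_mean (has_mean_cst _ ler01) => e; rewrite expr1n.
exists (m * z + c * (m ^+ n) ^+ 2).
  apply: (@eq_has_mean _ _ _ _ (fun e => bsum (Z n) e * bsum (Z n) e)).
    by move=> e; rewrite -ZnS expr2.
  rewrite [(m ^+ n) ^+ 2]expr2.
  exact: (has_mean_bsumM mu_box mu_on_label pkE pk_mean pk_var (has_mean_Zn n) (has_mean_Zn n) Zz).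
rewrite [m ^+ n.+1]exprS exprMn; set Q := (m ^+ n) ^+ 2 in zK *.
have Q0 : 0 <= Q by exact: sqr_ge0.
have H1 : m * z <= m * (K * Q) by apply: ler_wpM2l => //; exact: ltW.
have H2 : (K * m + c) * Q <= (K * m ^+ 2) * Q by exact: ler_wpM2r.
by lra.
Qed.

Lemma depends_Zn n : depends_on (predC1 (inr [::])) (Z n).
Proof. by case: n => [|n] e e' H //; have := depends_bsum (Z n) H; rewrite -ZnS. Qed.

Lemma flow_energy_bound : exists2 U, 0 < U & forall n,
  exists2 g, has_mean (flow_energy lam n) g & g <= U * (lam * m) ^+ n.
Proof.
have [K K0 HK] := Zn_sq_bound.
have kap0 := has_mean_ge0 has_mean_weight.
have wZ n z : has_mean (fun e => Z n e ^+ 2) z ->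
    has_mean (fun e => weight [::] e * Z n e ^+ 2) (kap * z).
  move=> Zz; apply: (has_mean_weightM mu_box (g := id)) => //.
  by move=> e e' H; rewrite (depends_Zn _ H).
have lm0 : 0 < lam - m by rewrite subr_gt0.
(* One generation multiplies the mean flow energy by [lam * m] and adds a source of order [m^(2n)],
   which grows more slowly as [m < lam]. Carrying [u * (m ^+ n) ^+ 2] through the induction absorbs
   the source when [kap K m + u m = lam u]. *)
pose u := kap * K * m / (lam - m).
have u0 : 0 <= u by nonneg.
have uE : kap * K * m + u * m = lam * u by rewrite /u; field; rewrite lt0r_neq0.
suff H n : exists2 g, has_mean (flow_energy lam n) g &
    g + u * (m ^+ n) ^+ 2 <= (1 + kap * K + u) * (lam * m) ^+ n.
  exists (1 + kap * K + u) => [|n]; first by rewrite ltr_wpDr// ltr_wpDr// mulr_ge0.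
  have [g gg gU] := H n; exists g => //; apply: le_trans gU.
  by rewrite lerDl mulr_ge0// sqr_ge0.
elim: n => [|n [g gg gU]].
  have [z /wZ Zz zK] := HK 0; exists (kap * z + 0).
    by apply: has_meanD => //; exact: has_mean_cst.
  rewrite !expr0 expr1n !mulr1 addr0 in zK *.
  have H : kap * z <= kap * K by exact: ler_wpM2l.
  by lra.
have [z /wZ Zz zK] := HK n.+1.
exists (kap * z + lam * (m * g)).
  apply: has_meanD => //; apply: has_meanZ; first exact: ltW.
  exact: (has_mean_bsum mu_box mu_on_label pkE pk_mean gg).
have zK' : kap * z <= kap * (K * (m ^+ n.+1) ^+ 2) by exact: ler_wpM2l.
have gU' : lam * m * (g + u * (m ^+ n) ^+ 2) <= lam * m * ((1 + kap * K + u) * (lam * m) ^+ n).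
  by apply: ler_wpM2l => //; rewrite mulr_ge0// ltW.
rewrite [(lam * m) ^+ n.+1]exprS [X in _ <= X]mulrCA; apply: le_trans gU'.
move: zK'; rewrite [m ^+ n.+1]exprS exprMn; set Q := (m ^+ n) ^+ 2 => zK'.
have -> : lam * m * (g + u * Q) = lam * (m * g) + m * (lam * u) * Q by ring.
rewrite -uE; have -> : m * (kap * K * m + u * m) * Q =
  kap * (K * (m ^+ 2 * Q)) + u * (m ^+ 2 * Q) by ring.
by lra.
Qed.

Lemma branch_mean_lower : exists2 U, 0 < U & forall n, U * q ^+ n <= al n.
Proof.
have [U U0 HU] := flow_energy_bound.
exists (U^-1) => [|n]; first by rewrite invr_gt0.
have [g gg gU] := HU n.
(* This [t] maximises [2 t m^n - t^2 U (lam m)^n], with maximum [U^-1 * q ^+ n]. *)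
pose t := (U * lam ^+ n)^-1.
have t0 : 0 < t by rewrite invr_gt0 mulr_gt0// exprn_gt0.
have H : 2 * t * m ^+ n <= al n + t ^+ 2 * g.
  apply: has_mean_le (has_meanZ _ (has_mean_Zn n))
    (has_meanD (has_mean_branch n) (has_meanZ (sqr_ge0 t) gg)) _.
    by rewrite mulr_ge0// ltW.
  by move=> e; exact: le_branch_cond_Zn.
have tg : t ^+ 2 * g <= t ^+ 2 * (U * (lam * m) ^+ n).
  by apply: ler_wpM2l => //; exact: sqr_ge0.
have E1 : t * m ^+ n = U^-1 * q ^+ n.
  by rewrite /t expr_div_n; field; rewrite !lt0r_neq0// exprn_gt0.
have E2 : t ^+ 2 * (U * (lam * m) ^+ n) = U^-1 * q ^+ n.
  by rewrite /t expr_div_n exprMn; field; rewrite !lt0r_neq0// exprn_gt0.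
rewrite -mulrA E1 in H; rewrite E2 in tg; lra.
Qed.

Lemma branch_mean_cvg : exists2 L : R, 0 < L & (fun n => al n / q ^+ n) @ \oo --> L.
Proof.
have [U U0 HU] := branch_mean_lower.
have lbU n : U <= al n / q ^+ n by rewrite ler_pdivlMr// exprn_gt0.
have ni : nonincreasing_seq (fun n => al n / q ^+ n).
  apply/nonincreasing_seqP => n.
  rewrite ler_pdivrMr ?exprn_gt0// [q ^+ n.+1]exprS mulrCA mulfVK.
    exact: branch_meanS.
  by rewrite lt0r_neq0// exprn_gt0.
have cv : cvgn (fun n => al n / q ^+ n).
  by apply: nonincreasing_is_cvgn => //; exists U => _ [n _ <-].
exists (limn (fun n => al n / q ^+ n)) => //.
by apply: lt_le_trans U0 _; apply: limr_ge => //; exact: nearW.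
Qed.


Let q1 : q < 1. Proof. by rewrite ltr_pdivrMr// mul1r. Qed.

(** * Almost sure limits *)

Lemma Zn_iter k : Z k = iter k (@bsum R) (Z 0).
Proof. by elim: k => //= k <-; rewrite -ZnS. Qed.

Lemma measurable_iter_bsum F k : measurable_fun setT F ->
  measurable_fun setT (iter k (@bsum R) F).
Proof. by move=> mF; elim: k => //= k IH; exact: measurable_bsum. Qed.

Lemma has_mean_iter_bsum F x k : has_mean F x ->
  has_mean (iter k (@bsum R) F) (m ^+ k * x).
Proof.
move=> Fx; elim: k => [|k IH] /=; first by rewrite expr0 mul1r.
by rewrite exprS -mulrA; exact: (has_mean_bsum mu_box mu_on_label pkE pk_mean IH).
Qed.

(* Conditionally on the first k generations, [iter k bsum F] is a sum of Z_k
   independent copies of F, so after centering its variance is m^k Var F. *)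
Lemma has_mean_iter_bsum_centered F x y k :
  has_mean F x -> has_mean (fun e => F e ^+ 2) y ->
  has_mean (fun e => (iter k (@bsum R) F e - x * Z k e) ^+ 2) (m ^+ k * (y - x ^+ 2)).
Proof.
move=> Fx Fy; have x0 := has_mean_ge0 Fx.
have Zk j : has_mean (Z j) (m ^+ j) by exact: has_mean_Zn.
(* The square is expanded because [has_mean] is confined to nonnegative functions. Under one
   generation each moment is multiplied by [m] and gains a multiple of [c]; the latter cancel in the
   combination. *)
suff [A [B [S [hA hB hS ABS]]]] : exists A B S,
    [/\ has_mean (fun e => iter k (@bsum R) F e * iter k (@bsum R) F e) A,
        has_mean (fun e => iter k (@bsum R) F e * Z k e) B,
        has_mean (fun e => Z k e * Z k e) S &
        A + x ^+ 2 * S - (2 * x) * B = m ^+ k * (y - x ^+ 2)].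
  rewrite -ABS.
  have sq := has_meanD hA (has_meanZ (sqr_ge0 x) hS).
  have cr : has_mean (fun e => 2 * x * (iter k (@bsum R) F e * Z k e)) (2 * x * B).
    by apply: has_meanZ => //; rewrite mulr_ge0.
  apply: eq_has_mean (has_meanB cr sq _) => e; first by ring.
  by rewrite -subr_ge0; have := sqr_ge0 (iter k (@bsum R) F e - x * Z k e); congr (_ <= _); ring.
elim: k => [|k [A [B [S [hA hB hS ABS]]]]].
  exists y, x, 1; split.
  - by apply: eq_has_mean Fy => e; rewrite expr2.
  - by apply: eq_has_mean Fx => e; rewrite /= mulr1.
  - by apply: eq_has_mean (has_mean_cst _ ler01) => e; rewrite /= mulr1.
  - by rewrite expr0; ring.
have Fk := has_mean_iter_bsum k Fx.
have pairing := has_mean_bsumM mu_box mu_on_label pkE pk_mean pk_var.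
exists (m * A + c * (m ^+ k * x * (m ^+ k * x))),
  (m * B + c * (m ^+ k * x * m ^+ k)), (m * S + c * (m ^+ k * m ^+ k)); split.
- exact: (pairing _ _ _ _ _ Fk Fk hA).
- apply: eq_has_mean (pairing _ _ _ _ _ Fk (Zk k) hB) => e.
  by rewrite -ZnS.
- apply: eq_has_mean (pairing _ _ _ _ _ (Zk k) (Zk k) hS) => e.
  by rewrite -ZnS.
- rewrite [m ^+ k.+1]exprS -[m * m ^+ k * _]mulrA -ABS; ring.
Qed.

(** The decay rate per generation of the relative standard deviation of a sum over a generation. *)
Let s := Num.sqrt m^-1.
Let s0 : 0 < s. Proof. by rewrite sqrtr_gt0 invr_gt0. Qed.
Let s1 : s < 1.
Proof. by rewrite -[ltRHS]sqrtr1 ltr_sqrt// invf_lt1. Qed.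
Let sE : s ^+ 2 = m^-1. Proof. by rewrite sqr_sqrtr// invr_ge0 ltW. Qed.

(** [Z_(k+1) - m Z_k] is the centred sum over generation [k] of the numbers of children, so the
    normalised increments have absolute means O(s^k) and their series converges absolutely. *)
Lemma ae_cvg_Zn : {ae mu, forall e, cvgn (fun n => Z n e / m ^+ n)}.
Proof.
have [K K0 HK] := Zn_sq_bound.
have [y Zy _] := HK 1.
have Z1 := has_mean_Zn 1.
pose X k e := m ^- k.+1 * (Z k.+1 e - m * Z k e).
pose v := y - m ^+ 2.
have Xv k : has_mean (fun e => X k e ^+ 2) ((m ^- k.+1) ^+ 2 * (m ^+ k * v)).
  rewrite /X; apply: (@eq_has_mean _ _ _ _ (fun e => (m ^- k.+1) ^+ 2 *
      (iter k (@bsum R) (Z 1) e - m ^+ 1 * Z k e) ^+ 2)).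
    move=> e; rewrite exprMn expr1; congr (_ * (_ - _) ^+ 2).
    by have /(congr1 (fun f => f e)) := Zn_iter k.+1; rewrite iterSr -ZnS.
  apply: has_meanZ; first exact: sqr_ge0.
  exact: has_mean_iter_bsum_centered.
have mZ n : measurable_fun setT (Z n) by exact: measurable_Zn.
have mX k : measurable_fun setT (X k).
  apply: measurable_funM; first exact: measurable_cst.
  by apply: measurable_funB => //; apply: measurable_funM => //; exact: measurable_cst.
have /choice[x Hx] : forall k, exists x, has_mean (fun e => `|X k e|) x /\
    x <= (1 + v / m ^+ 2) * s ^+ k.
  move=> k; have [x Xx xb] := has_mean_norm (mX k) (Xv k) (exprn_gt0 k s0).
  exists x; split => //; apply: le_trans xb _.
  rewrite mulrDl mul1r lerD2l ler_pdivrMr ?exprn_gt0//.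
  have -> : v / m ^+ 2 * s ^+ k * s ^+ k = v / m ^+ 2 * (s ^+ 2) ^+ k.
    by rewrite exprAC; ring.
  rewrite sE le_eqVlt; apply/orP; left; apply/eqP.
  rewrite [m^-1 ^+ k]exprVn [m ^+ k.+1]exprS; field.
  by rewrite lt0r_neq0 ?exprn_gt0//= lt0r_neq0.
have sx : cvgn (series x).
  apply: (@series_le_cvg _ _ (geometric (1 + v / m ^+ 2) s)).
  - by move=> k; exact: has_mean_ge0 (Hx k).1.
  - move=> k; exact: le_trans (has_mean_ge0 (Hx k).1) (Hx k).2.
  - by move=> k; exact: (Hx k).2.
  - by apply: is_cvg_geometric_series; rewrite ger0_norm// ltW.
have := ae_summable (fun k => (Hx k).1) sx.
apply: filterS => e /normed_cvg cX.
rewrite (_ : (fun n => _) = (fun n => 1 + series (X ^~ e) n)).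
  by apply: is_cvgD => //; exact: is_cvg_cst.
apply/funext => n; elim: n => [|n IH].
  by rewrite /series /= big_geq// addr0 expr0 divr1.
rewrite seriesS addrCA -IH /X exprS; field.
by rewrite lt0r_neq0 ?exprn_gt0//= lt0r_neq0.
Qed.

Lemma le_bsum F G e : (forall e', F e' <= G e') -> bsum F e <= bsum G e :> R.
Proof. by move=> FG; apply: ler_sum. Qed.

Lemma bsumZ a F : bsum (fun e => a * F e) = (fun e => a * bsum F e) :> (E -> R).
Proof. by apply/funext => e; rewrite /bsum mulr_sumr. Qed.

(** Rayleigh monotonicity: the right-hand side is the conductance after joining the first [k]
    generations to the root. *)
Lemma tree_le_iter k j e :
  C (k + j) e <= lam^-1 ^+ k * iter k (@bsum R) (C j) e.
Proof.
elim: k e => [|k IH] e; first by rewrite mul1r.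
have lV : 0 <= lam^-1 by rewrite invr_ge0 ltW.
rewrite exprS -mulrA addSn {1}/tree_cond; apply: ler_wpM2l => //=.
apply: (@le_trans _ _ (bsum (fun e => lam^-1 ^+ k * iter k (@bsum R) (C j) e) e)).
  apply: le_bsum => e'; apply: le_trans (IH e'); exact: branch_le_tree.
by rewrite bsumZ.
Qed.

(** A one-step loss of order [q^(2n)] becomes [q^n] after normalisation; the geometric tail from [j]
    on bounds the total loss uniformly in [k]. *)
Lemma branch_mean_gap : exists2 B, 0 <= B & forall j k,
  al j.+1 / q ^+ j.+1 - al (k + j.+1)%N / q ^+ (k + j.+1) <= B * q ^+ j.
Proof.
have [B B0 HB] := branch_mean_decrement.
have q10 : 0 < 1 - q by rewrite subr_gt0.
have qn n : 0 < q ^+ n by exact: exprn_gt0.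
have step n : al n.+1 / q ^+ n.+1 - al n.+2 / q ^+ n.+2 <= B * q ^+ n.
  have : (q * al n.+1 - B * (q ^+ n.+2) ^+ 2) / q ^+ n.+2 <= al n.+2 / q ^+ n.+2.
    by rewrite ler_pM2r ?invr_gt0.
  have -> : (q * al n.+1 - B * (q ^+ n.+2) ^+ 2) / q ^+ n.+2 =
      al n.+1 / q ^+ n.+1 - B * q ^+ n.+2.
    have := qn n; rewrite !exprS; move: (q ^+ n) => Q Q0.
    by field; rewrite !lt0r_neq0.
  have : B * q ^+ n.+2 <= B * q ^+ n.
    by apply: ler_wpM2l => //; apply: ler_wiXn2l; rewrite ?ltW// -addn2 leq_addr.
  by lra.
exists (B / (1 - q)) => [|j k]; first by rewrite divr_ge0// ltW.
suff H : al j.+1 / q ^+ j.+1 - al (k + j.+1)%N / q ^+ (k + j.+1) <=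
    B / (1 - q) * (q ^+ j - q ^+ (k + j)).
  apply: le_trans H _; apply: ler_wpM2l; first by rewrite divr_ge0// ltW.
  by rewrite gerBl exprn_ge0// ltW.
elim: k => [|k IH]; first by rewrite !add0n !subrr mulr0.
have := step (k + j)%N; rewrite -!addnS !addSn -addnS => st.
have -> : B / (1 - q) * (q ^+ j - q ^+ (k + j).+1) =
    B / (1 - q) * (q ^+ j - q ^+ (k + j)) + B * q ^+ (k + j).
  by rewrite exprS; field; rewrite lt0r_neq0//= lt0r_neq0// subr_gt0.
by lra.
Qed.


(** The cut is at generation [uphalf n]; the remaining index [n./2.+1] is never 0, as second moments
    of [C] are bounded from index 1 on. *)
Let short_circuit n e : R :=
  lam^-1 ^+ uphalf n * iter (uphalf n) (@bsum R) (C n./2.+1) e.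

Let half_depth n : (uphalf n + n./2.+1 = n.+1)%N.
Proof. by rewrite addnS uphalf_half -addnA addnn odd_double_half. Qed.

(** The error is nonnegative by [tree_le_iter], so its L^1 norm is a difference of means, which
    [branch_mean_gap] bounds by a multiple of [q ^+ n./2]. *)
Lemma ae_short_circuit :
  {ae mu, forall e, (fun n => (short_circuit n e - C n.+1 e) / q ^+ n.+1) @ \oo --> 0}.
Proof.
have [B B0 HB] := branch_mean_gap.
have qn k : 0 < q ^+ k by exact: exprn_gt0.
have le_short n e : C n.+1 e <= short_circuit n e.
  by rewrite -{1}(half_depth n); exact: tree_le_iter.
pose f n e := q ^- n.+1 * (short_circuit n e - C n.+1 e).
pose x n := q ^- n.+1 * (lam^-1 ^+ uphalf n * (m ^+ uphalf n * (q * al n./2.+1)) - q * al n.+1).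
have fx n : has_mean (f n) (x n).
  apply: has_meanZ; first by rewrite invr_ge0 ltW.
  apply: (has_meanB (has_mean_tree n.+1)) => //.
  apply: has_meanZ; first by rewrite exprn_ge0// invr_ge0 ltW.
  exact: has_mean_iter_bsum (has_mean_tree _).
have xE n : x n <= q * B * q ^+ n./2.
  have := HB n./2 (uphalf n); rewrite half_depth => /(ler_wpM2l (ltW q0)).
  rewrite [X in _ <= X]mulrA; apply: le_trans; rewrite le_eqVlt; apply/orP; left; apply/eqP.
  rewrite /x [lam^-1 ^+ _ * _]mulrA -exprMn [lam^-1 * m]mulrC.
  rewrite -(half_depth n) exprD.
  move: (al _) (al _) (qn (uphalf n)) (qn n./2.+1) => a b.
  move: (q ^+ _) (q ^+ _) => Q1 Q2 Q10 Q20.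
  by field; rewrite !lt0r_neq0.
have sx := cvg_series_half_power q0 q1 (fun n => has_mean_ge0 (fx n)) xE.
have := ae_summable fx sx.
apply: filterS => e /cvg_series_cvg_0 H.
by apply: cvg_trans H; apply: near_eq_cvg; near=> n; rewrite /f mulrC.
Unshelve. all: by end_near.
Qed.

Lemma ae_short_circuit_centered : {ae mu, forall e,
  (fun n => (short_circuit n e - lam^-1 ^+ uphalf n * (q * al n./2.+1) * Z (uphalf n) e)
     / q ^+ n.+1) @ \oo --> 0}.
Proof.
have [B B0 HB] := tree_sq_bound.
have qn k : 0 < q ^+ k by exact: exprn_gt0.
pose X n e := lam^-1 ^+ uphalf n / q ^+ n.+1 *
  (iter (uphalf n) (@bsum R) (C n./2.+1) e - q * al n./2.+1 * Z (uphalf n) e).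
have mX n : measurable_fun setT (X n).
  apply: measurable_funM; first exact: measurable_cst.
  apply: measurable_funB.
    by apply: measurable_iter_bsum; exact: measurable_tree_cond.
  by apply: measurable_funM; [exact: measurable_cst|exact: measurable_Zn].
have /choice[x Hx] : forall n, exists x, has_mean (fun e => `|X n e|) x /\
    x <= (1 + B * q ^+ 2) * s ^+ n./2.
  move=> n; have [b Cb bB] := HB n./2.
  have Xv : has_mean (fun e => X n e ^+ 2) ((lam^-1 ^+ uphalf n / q ^+ n.+1) ^+ 2 *
      (m ^+ uphalf n * (b - (q * al n./2.+1) ^+ 2))).
    apply: (@eq_has_mean _ _ _ _ (fun e => (lam^-1 ^+ uphalf n / q ^+ n.+1) ^+ 2 *
      (iter (uphalf n) (@bsum R) (C n./2.+1) e - q * al n./2.+1 * Z (uphalf n) e) ^+ 2)).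
      by move=> e; rewrite -exprMn.
    apply: has_meanZ; first exact: sqr_ge0.
    exact: has_mean_iter_bsum_centered (has_mean_tree _) Cb.
  (* With [t] of the order of the standard deviation, both [t] and [v / t] are O(s^(uphalf n)). *)
  have [x Xx xb] := has_mean_norm (mX n) Xv (exprn_gt0 (uphalf n) s0).
  exists x; split => //; apply: le_trans xb _.
  apply: (@le_trans _ _ ((1 + B * q ^+ 2) * s ^+ uphalf n)); last first.
    apply: ler_wpM2l; first by rewrite addr_ge0// mulr_ge0// exprn_ge0// ltW.
    by apply: ler_wiXn2l; rewrite ?ltW// uphalf_half leq_addl.
  rewrite mulrDl mul1r lerD2l ler_pdivrMr ?exprn_gt0//.
  have -> : B * q ^+ 2 * s ^+ uphalf n * s ^+ uphalf n = B * q ^+ 2 * (s ^+ 2) ^+ uphalf n.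
    by rewrite exprAC; ring.
  rewrite sE.
  have -> : B * q ^+ 2 * m^-1 ^+ uphalf n =
      (lam^-1 ^+ uphalf n / q ^+ n.+1) ^+ 2 * (m ^+ uphalf n * (B * (q ^+ n./2.+2) ^+ 2)).
    rewrite -(half_depth n) exprD [q ^+ n./2.+2]exprS.
    rewrite [q ^+ uphalf n]expr_div_n [lam^-1 ^+ _]exprVn [m^-1 ^+ _]exprVn.
    move: (qn n./2.+1) (exprn_gt0 (uphalf n) m0) (exprn_gt0 (uphalf n) lam0) q0.
    move: (q ^+ n./2.+1) (m ^+ _) (lam ^+ _) q => Q M L r Q0 M0 L0 r0.
    by field; rewrite !lt0r_neq0.
  apply: ler_wpM2l; first exact: sqr_ge0.
  apply: ler_wpM2l; first by rewrite exprn_ge0// ltW.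
  by apply: le_trans bB; rewrite gerBl sqr_ge0.
have sx := cvg_series_half_power s0 s1 (fun n => has_mean_ge0 (Hx n).1) (fun n => (Hx n).2).
have := ae_summable (fun n => (Hx n).1) sx.
apply: filterS => e /cvg_to0_of_norm_series H.
apply: cvg_trans H; apply: near_eq_cvg; near=> n; rewrite /X /short_circuit.
by rewrite /=; ring.
Unshelve. all: by end_near.
Qed.

Theorem ae_tree_cond_ratio : {ae mu, forall e,
  (fun n => C n e / (q * al n)) @ \oo --> limn (fun n => Z n e / m ^+ n)}.
Proof.
have [L L0 aL] := branch_mean_cvg; have [U U0 HU] := branch_mean_lower.
have qn k : 0 < q ^+ k by exact: exprn_gt0.
have al0 k : 0 < al k by apply: lt_le_trans (HU k); exact: mulr_gt0.
have uphalf_cvg : uphalf n @[n --> \oo] --> \oo.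
  apply/cvgnyPge => A; exists A.*2 => // n /= An.
  by rewrite -(uphalf_double A) uphalf_leq.
have half_cvg : n./2.+1 @[n --> \oo] --> \oo.
  apply/cvgnyPge => A; exists A.*2 => // n /= An.
  by apply: leqW; rewrite -(doubleK A) half_leq.
have := ae_short_circuit; have := ae_short_circuit_centered; have := ae_cvg_Zn.
apply: filterS3 => e cW c1 c2.
set W := limn _.
have ga0 : (fun n => al n.+1 / q ^+ n.+1) @ \oo --> L.
  by rewrite (cvg_shiftS (fun n => al n / q ^+ n)).
have cW' : (fun n => Z n e / m ^+ n) @ \oo --> W by exact: cW.
have H : (fun n => C n.+1 e / q ^+ n.+1) @ \oo --> q * L * W.
  have c3 : (fun n => q * (al n./2.+1 / q ^+ n./2.+1) * (Z (uphalf n) e / m ^+ uphalf n))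
      @ \oo --> q * L * W.
    apply: cvgM.
      by apply: cvgM; [exact: cvg_cst|exact: (cvg_comp _ _ half_cvg aL)].
    exact: (cvg_comp _ _ uphalf_cvg cW').
  (* Centred fluctuation, minus short-circuit error, plus the conditional mean given the generations
     above the cut; the first two tend to 0. *)
  rewrite (_ : (fun n => _) = (fun n =>
      (short_circuit n e - lam^-1 ^+ uphalf n * (q * al n./2.+1) * Z (uphalf n) e) / q ^+ n.+1
      - (short_circuit n e - C n.+1 e) / q ^+ n.+1
      + q * (al n./2.+1 / q ^+ n./2.+1) * (Z (uphalf n) e / m ^+ uphalf n))).
    by rewrite -[q * L * W]add0r -[in X in _ --> X](subr0 0); apply: cvgD => //; exact: cvgB.
  apply/funext => n.
  rewrite -(half_depth n) exprD [q ^+ uphalf n]expr_div_n [lam^-1 ^+ _]exprVn.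
  move: (qn n./2.+1) (exprn_gt0 (uphalf n) m0) (exprn_gt0 (uphalf n) lam0).
  move: (q ^+ _) (m ^+ _) (lam ^+ _) => Q M l Q0 M0 l0.
  by field; rewrite !lt0r_neq0.
rewrite -(cvg_shiftS (fun n => C n e / (q * al n))) /=.
have LW : W = q * L * W / (q * L) by field; rewrite !lt0r_neq0.
rewrite LW.
rewrite (_ : (fun n => _) = (fun n => C n.+1 e / q ^+ n.+1 * (q * (al n.+1 / q ^+ n.+1))^-1)).
  apply: cvgM => //; apply: cvgV; first by rewrite lt0r_neq0// mulr_gt0.
  by apply: cvgM => //; exact: cvg_cst.
apply/funext => n; have := al0 n.+1; have := qn n.+1; move: (q ^+ _) (al _) => Q a Q0 a0.
by field; rewrite !lt0r_neq0.
Qed.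

End Moments.

(** * Transfer to the given probability space *)


Section Transfer.
Context {d : measure_display} {T : measurableType d} {R : realType}.
Variables (P : probability T R) (p : nat -> R) (m : R).
Variables (N : label -> T -> nat) (xi : label -> T -> R) (lam : R).
Hypothesis p_mean : series (fun k => k%:R * p k) @ \oo --> m.
Hypothesis m1 : 1 < m.
Hypothesis mN : forall v, measurable_fun setT (fun w => (N v w)%:R : R).
Hypothesis mxi : forall v, measurable_fun setT (xi v).
Hypothesis indep : mutually_independent P
    (fun (i : label + label) w =>
       match i with inl v => (N v w)%:R | inr v => xi v w end).
Hypothesis N_law : forall v k, P [set w | N v w = k] = (p k)%:E.
Hypothesis xi_law :
  forall v B, measurable B -> P (xi v @^-1` B) = P (xi [::] @^-1` B).
Hypothesis xi_gt0 : forall v w, 0 < xi v w.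
Hypothesis mlam : m < lam.
Local Notation E := (env (label + label)%type R).

Definition environment (w : T) : E := fun i =>
  match i with inl v => (N v w)%:R | inr v => xi v w end.

Lemma measurable_environment : measurable_fun setT environment.
Proof. by apply: measurable_env => -[v|v]; [exact: mN|exact: mxi]. Qed.

Lemma nchild_environment v w : nchild v (environment w) = N v w.
Proof. by apply: truncn_def; rewrite lexx ltr_nat /=. Qed.

Lemma weight_environment v w : weight v (environment w) = xi v w.
Proof. by rewrite /weight /= xi_gt0. Qed.

Let X : {mfun T >-> E} := mfun_Sub (mem_set measurable_environment).
Let mu : probability E R := distribution P X.

Let mu_box s B : uniq s -> finite_box s B ->
  mu (box B) = (\prod_(i <- s) mu [set e | B i (e i)])%E.
Proof. by move=> us fB; rewrite (box_bigcap fB); exact: (indep us fB.1). Qed.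

(** The law of [N v] is given through its atoms; summing them reaches every Borel event and shows
    that the law is the same for all [v]. *)
Let N_preimage v (B : set R) : measurable B ->
  P [set w | B (N v w)%:R] = (\sum_(k <oo | k \in [set k | B k%:R]) (p k)%:E)%E.
Proof.
move=> mB; have -> : [set w | B (N v w)%:R] =
    \bigcup_(k in [set k : nat | B k%:R]) [set w | N v w = k].
  by apply/seteqP; split => [w Bw|w [k /= Bk wk]]; [exists (N v w)|rewrite /= wk].
rewrite measure_bigcup.
- by apply: eq_eseriesr => k _; exact: N_law.
- move=> k _; rewrite (_ : [set w | _] = (fun w => (N v w)%:R : R) @^-1` [set k%:R]).
    by rewrite -[X in measurable X]setTI; apply: mN.
  by apply/seteqP; split => w /= => [->//|/eqP]; rewrite eqr_nat => /eqP.
- by apply/trivIsetP => i j _ _ ij; apply/seteqP; split => // w [/= wi wj]; move: ij; rewrite -wi -wj eqxx.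
Qed.

Let mu_on_label g j B : measurable B ->
  mu [set e | B (e (on_label g j))] = mu [set e | B (e j)].
Proof.
move=> mB; case: j => v.
- by transitivity (P [set w | B (N (g v) w)%:R]) => //; rewrite N_preimage// -(N_preimage v).
- transitivity (P (xi (g v) @^-1` B)) => //.
  by rewrite xi_law// -(xi_law v).
Qed.

Let pkE k : mu [set e | nchild [::] e = k] = (p k)%:E.
Proof.
rewrite -(N_law [::]); congr (P _).
by apply/seteqP; split => w /=; rewrite nchild_environment.
Qed.

Lemma has_mean_environment (F : E -> R) x : measurable_fun setT F ->
  (forall e, 0 <= F e) -> has_mean P (F \o environment) x -> has_mean mu F x.
Proof.
move=> mF F0 [_ _ Fx]; split => //; rewrite -Fx.
by rewrite ge0_integral_distribution//; exact/measurable_EFinP.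
Qed.

Lemma gen_environment k w : gen N w k = gen (@nchild R) (environment w) k.
Proof.
elim: k => //= k ->; congr flatten; apply: eq_map => v.
by rewrite nchild_environment.
Qed.

Lemma eff_cond_environment n w :
  eff_cond N w xi lam n.+1 = tree_cond lam n (environment w).
Proof.
rewrite -eff_cond_tree_cond; last first.
  by apply: lt_trans mlam; apply: lt_trans m1.
rewrite /eff_cond; congr (inf _).
have EE f : energy N w xi lam n.+1 f = energy (@nchild R) (environment w) (@weight R) lam n.+1 f.
  rewrite /energy; apply: eq_bigr => k _; rewrite gen_environment.
  by apply: eq_bigr => x _; rewrite weight_environment.
by apply/seteqP; split => _ [f [f1 f0] <-]; exists f => //;
  split => // x; rewrite ?gen_environment => xk; apply: f0; rewrite ?gen_environment.
Qed.

Hypothesis moments :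
  (\int[P]_w (xi [::] w + (xi [::] w)^-1 + (N [::] w)%:R ^+ 2)%:E < +oo)%E.

Theorem conductance_asymptotics :
  {ae P, forall w,
     (fun n => Cn N xi lam n w / ECn P N xi lam n) @ \oo --> Wlim N m w} /\
  exists L : R, 0 < L /\ (fun n => (lam / m) ^+ n * ECn P N xi lam n) @ \oo --> L.
Proof.
have m0 : 0 < m by apply: lt_trans m1.
have lam0 : 0 < lam by apply: lt_trans mlam.
have q0 : 0 < m / lam by exact: divr_gt0.
have mw : measurable_fun setT (weight [::] : E -> R) by exact: measurable_weight.
have mwV : measurable_fun setT (fun e : E => (weight [::] e)^-1).
  rewrite (_ : (fun e => _) = fun e => (weight [::] e) `^ (-1)); last first.
    by apply/funext => e; rewrite powR_inv1// ltW// weight_gt0.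
  exact: (measurableT_comp (measurable_powR (-1)) mw).
have mN2 : measurable_fun setT (fun e : E => (nchild [::] e)%:R ^+ 2 : R).
  exact: (measurable_nchildR [::] (fun k => k%:R ^+ 2)).
have dom (F : E -> R) : measurable_fun setT F -> (forall e, 0 <= F e) ->
    (forall w, F (environment w) <= xi [::] w + (xi [::] w)^-1 + (N [::] w)%:R ^+ 2) ->
    exists x, has_mean mu F x.
  move=> mF F0 FX; have [x Fx] : exists x, has_mean P (F \o environment) x.
    apply: has_mean_lty; [exact: measurableT_comp mF measurable_environment|by move=> w; exact: F0|].
    apply: le_lt_trans moments; apply: ge0_le_integral => //.
    - by move=> w _; rewrite lee_fin; exact: F0.
    - by apply/measurable_EFinP; exact: measurableT_comp mF measurable_environment.
    - apply/measurable_EFinP.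
      rewrite (_ : (fun w => _) = (fun e : E => weight [::] e + (weight [::] e)^-1 +
          (nchild [::] e)%:R ^+ 2) \o environment).
        apply: measurableT_comp measurable_environment.
        by apply: measurable_funD => //; exact: measurable_funD.
      by apply/funext => w /=; rewrite weight_environment nchild_environment.
    - by move=> w _; rewrite lee_fin; exact: FX.
  by exists x; exact: has_mean_environment.
have V0 w : 0 <= (xi [::] w)^-1 by rewrite invr_ge0 ltW.
have [kap hkap] : exists x, has_mean mu (weight [::]) x.
  apply: dom => // [e|w]; first by rewrite ltW// weight_gt0.
  by rewrite weight_environment -addrA lerDl addr_ge0 ?sqr_ge0.
have [io hio] : exists x, has_mean mu (fun e => (weight [::] e)^-1) x.
  apply: dom => // [e|w]; first by rewrite invr_ge0 ltW// weight_gt0.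
  by rewrite weight_environment addrAC lerDr addr_ge0 ?sqr_ge0// ltW.
have [z hz] : exists x, has_mean mu (fun e => (nchild [::] e)%:R ^+ 2) x.
  apply: dom => // w.
  by rewrite nchild_environment lerDr addr_ge0// ltW.
have [c c0 p_var] := cvg_factorial_moment pkE hz.
have EC n : ECn P N xi lam n.+1 = m / lam * branch_mean mu lam n.
  rewrite /ECn /Cn; have [mC C0 CE] := has_mean_tree mu_box mu_on_label pkE p_mean m1 mlam hio n.
  under eq_integral do rewrite eff_cond_environment.
  rewrite -[RHS]/(fine (_)%:E) -CE; congr fine.
  by rewrite ge0_integral_distribution//; exact/measurable_EFinP.
split.
- have := ae_tree_cond_ratio mu_box mu_on_label pkE p_mean p_var c0 m1 mlam hkap hio.
  move=> [A [mA A0 HA]]; exists (environment @^-1` A); split => //.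
    by rewrite -[X in measurable X]setTI; exact: measurable_environment.
  move=> w /= Hw; apply: HA => /= HC; apply: Hw.
  (* At depth 0 no potential is admissible, so the identification with [tree_cond] starts at depth
     1; the shift does not affect the limit. *)
  rewrite -(cvg_shiftS (fun n => Cn N xi lam n w / ECn P N xi lam n)) /= /Wlim.
  rewrite (_ : (fun n => (Zn N w n)%:R / m ^+ n) =
     (fun n => (Zn (@nchild R) (environment w) n)%:R / m ^+ n)); last first.
    by apply/funext => n; rewrite /Zn gen_environment.
  rewrite (_ : (fun n => _) = (fun n => tree_cond lam n (environment w) /
     (m / lam * branch_mean mu lam n)))//.
  by apply/funext => n; rewrite EC /Cn eff_cond_environment.
- have [L L0 HL] := branch_mean_cvg mu_box mu_on_label pkE p_mean p_var c0 m1 mlam hkap hio.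
  exists L; split => //.
  rewrite -(cvg_shiftS (fun n => (lam / m) ^+ n * ECn P N xi lam n)) /=.
  rewrite (_ : (fun n => _) = (fun n => branch_mean mu lam n / (m / lam) ^+ n))//.
  apply/funext => n; rewrite EC -invf_div exprVn [_ ^+ n.+1]exprS.
  have := exprn_gt0 n q0; move: ((m / lam) ^+ n) (m / lam) q0 => Q q q0 Q0.
  by field; rewrite !lt0r_neq0.
Qed.

End Transfer.

Theorem theorem7p1 (d : measure_display) (T : measurableType d)
  (R : realType) (P : probability T R)
  (p : nat -> R) (m : R)
  (N : label -> T -> nat) (xi : label -> T -> R) (lam : R) :
  (* offspring distribution *)
  (forall k, 0 <= p k) ->
  ((fun n => \sum_(0 <= k < n) p k) @ \oo --> (1 : R)) ->
  p 0 = 0 ->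
  ((fun n => \sum_(0 <= k < n) k%:R * p k) @ \oo --> m) ->
  1 < m ->
  (* measurability *)
  (forall v, measurable_fun setT (fun w => (N v w)%:R : R)) ->
  (forall v, measurable_fun setT (xi v)) ->
  (* all offspring numbers and all edge weights mutually independent *)
  mutually_independent P
    (fun (i : label + label) w =>
       match i with inl v => (N v w)%:R | inr v => xi v w end) ->
  (* each offspring number has law p *)
  (forall v k, P [set w | N v w = k] = (p k)%:E) ->
  (* the edge weights are copies of xi := xi [::], strictly positive *)
  (forall v B, measurable B -> P (xi v @^-1` B) = P (xi [::] @^-1` B)) ->
  (forall v w, 0 < xi v w) ->
  m < lam ->
  ((\int[P]_w (xi [::] w + (xi [::] w)^-1 + (N [::] w)%:R ^+ 2)%:E < +oo)%E ->
     {ae P, forall w,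
        (fun n => Cn N xi lam n w / ECn P N xi lam n) @ \oo --> Wlim N m w})
  /\
  ((\int[P]_w ((xi [::] w) ^+ 2 + (xi [::] w)^-1 + (N [::] w)%:R ^+ 3)%:E
      < +oo)%E ->
     exists L : R, 0 < L /\
       (fun n => (lam / m) ^+ n * ECn P N xi lam n) @ \oo --> L).
Proof.
move=> _ _ _ p_mean m1 mN mxi indep N_law xi_law xi_gt0 mlam.
have main := conductance_asymptotics p_mean m1 mN mxi indep N_law xi_law xi_gt0 mlam.
split=> [/main[]//|moments].
apply: (main _).2.
have mV : measurable_fun setT (fun w => (xi [::] w)^-1).
  rewrite (_ : (fun w => _) = fun w => (xi [::] w) `^ (-1)); last first.
    by apply/funext => w; rewrite powR_inv1// ltW.
  exact: (measurableT_comp (measurable_powR (-1)) (mxi [::])).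
have V0 w : 0 <= (xi [::] w)^-1 by rewrite invr_ge0 ltW.
have mX n k : measurable_fun setT (fun w => xi [::] w ^+ n + (xi [::] w)^-1 + (N [::] w)%:R ^+ k).
  by apply: measurable_funD; [apply: measurable_funD => //|]; exact: measurable_funX.
have [y Hy] := has_mean_lty (mX 2 3) (fun w =>
  addr_ge0 (addr_ge0 (sqr_ge0 _) (V0 w)) (exprn_ge0 3 (ler0n _ _))) moments.
have [|w|w|x [_ _ ->]] := @has_mean_dom _ _ _ P
  (fun w => xi [::] w + (xi [::] w)^-1 + (N [::] w)%:R ^+ 2) _ _ _ _
  (has_meanD (has_mean_cst P ler01) Hy); last exact: ltry.
- exact: (mX 1 2).
- by rewrite !addr_ge0 ?sqr_ge0// ltW.
- have : (N [::] w)%:R ^+ 2 <= (N [::] w)%:R ^+ 3 :> R.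
    by rewrite -!natrX ler_nat; case: (N [::] w) => // k; rewrite leq_pexp2l.
  have : xi [::] w <= 1 + xi [::] w ^+ 2 by have := sqr_ge0 (xi [::] w - 1); have := xi_gt0 [::] w; nra.
  lra.
Qed.
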